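(* Let $X$ be an infinite-dimensional real Banach space with unit ball $B_X$ and dual unit ball $B_{X^*}$, the latter viewed as a class of functions on $B_X$. Then $\mathrm{VC}(\varepsilon, B_{X^*}, B_X)$ is finite for every $\varepsilon>0$ if and only if $X$ has a nontrivial type. Moreover, if $X$ has type $p$ for some $p>1$, with type $p$ constant $T_p(X)$, and $p^*=\sup\{r : X \text{ has type } r\}$, then for every $\varepsilon>0$ $$\left(\frac{1}{\varepsilon}\right)^{p^*/(p^*-1)} - 1 \;\le\; \mathrm{VC}(\varepsilon, B_{X^*}, B_X) \;\le\; \left(\frac{T_p(X)}{\varepsilon}\right)^{p/(p-1)} + 1 .$$
   Context: Shattering dimension: for $\varepsilon>0$, a finite set $\sigma=\{x_1,\dots,x_n\}\subset\Omega$ of $n$ distinct points is $\varepsilon$-shattered by a class $F$ of real functions on $\Omega$ if there is $s:\sigma\to\mathbb{R}$ such that for every $I\subset\{1,\dots,n\}$ there is $f_I\in F$ with $f_I(x_i)\ge s(x_i)+\varepsilon$ for $i\in I$ and $f_I(x_i)\le s(x_i)-\varepsilon$ for $i\notin I$. $\mathrm{VC}(\varepsilon,F,\Omega)=\sup\{|\sigma| : \sigma\subset\Omega \text{ is } \varepsilon\text{-shattered by } F\}$. Type: a Banach space $X$ has type $p$ if there is a constant $C$ such that for every $n$ and all $x_1,\dots,x_n\in X$, $\mathbb{E}\|\sum_{i=1}^n\varepsilon_i x_i\|\le C(\sum_{i=1}^n\|x_i\|^p)^{1/p}$, where $(\varepsilon_i)$ are independent Rademacher variables ($\pm1$ with probability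 $1/2$ each); the smallest such $C$ is $T_p(X)$. Every Banach space has type 1, and $1\le p^*\le 2$ for $p^*=\sup\{p: X\text{ has type }p\}$. $X$ has trivial type if $p^*=1$, and nontrivial type if $p^*>1$. *)

(* Defs.v *)
From mathcomp Require Import all_boot all_order all_algebra.
From mathcomp Require Import all_classical all_reals all_analysis.

Set Implicit Arguments.
Unset Strict Implicit.
Unset Printing Implicit Defensive.

Import Order.TTheory GRing.Theory Num.Theory.
Import numFieldNormedType.Exports.

Local Open Scope classical_set_scope.
Local Open Scope ring_scope.

Section Shattering.
Context {R : realType} {T : Type}.
Implicit Types (eps : R) (F : set (T -> R)) (Omega : set T) (n : nat).

(* The finite set sigma is given by an enumeration x; only the values of s at
   the points of sigma matter. *)
Definition shattered eps F n (x : 'I_n -> T) : Prop :=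
  exists s : T -> R, forall I : {set 'I_n}, exists2 f : T -> R, F f &
    (forall i, i \in I -> s (x i) + eps <= f (x i)) /\
    (forall i, i \notin I -> f (x i) <= s (x i) - eps).

Definition VC eps F Omega : \bar R :=
  ereal_sup [set (n%:R)%:E | n in
    [set n : nat | exists x : 'I_n -> T,
       [/\ injective x, forall i, Omega (x i) & shattered eps F x]]].

End Shattering.

Section Banach.
Context {R : realType} (X : completeNormedModType R).

Definition infinite_dimensional : Prop :=
  ~ exists n (b : 'I_n -> X), forall x, exists c : 'I_n -> R,
      x = \sum_(i < n) c i *: b i.

Definition unit_ball : set X := [set x | `|x| <= 1].

(* Meaningful for continuous linear f, for which the supremum is finite. *)
Definition dual_norm (f : X -> R) : R := sup [set `|f x| | x in unit_ball].

Definition dual_unit_ball : set (X -> R) :=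
  [set f : X -> R | [/\ scalar f, continuous f & dual_norm f <= 1]].

(* E || \sum_i eps_i x_i ||: a vector of n independent Rademacher variables is
   uniformly distributed on the 2 ^ n sign vectors. *)
Definition rademacher_mean n (x : 'I_n -> X) : R :=
  (2 ^+ n)^-1 *
  \sum_(e : {ffun 'I_n -> bool}) `|\sum_(i < n) (-1) ^+ e i *: x i|.

Definition type_bound (p C : R) : Prop :=
  forall n (x : 'I_n -> X),
    rademacher_mean x <= C * (\sum_(i < n) `|x i| `^ p) `^ p^-1.

Definition has_type (p : R) : Prop := 1 <= p /\ exists C, type_bound p C.

(* For X != 0 the admissible constants form a closed set of nonnegative reals,
   so that this infimum is the smallest admissible constant. *)
Definition type_constant (p : R) : R := inf [set C | type_bound p C].

(* A real supremum: every X has type 1, and no nonzero X has type p > 2. *)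
Definition type_sup : R := sup [set p | has_type p].

Definition nontrivial_type : Prop := 1 < type_sup.

End Banach.

Arguments unit_ball {R} X.
Arguments dual_unit_ball {R} X.

(* Main.v *)
(** Hahn-Banach turns shattering into geometry: [x_1, ..., x_n] in [B_X] is
    eps-shattered iff [eps * sum |a_i| <= ||sum a_i x_i||] for all [a]
    ([lower_l1]). Averaging this over signs gives the upper bound.

    Everything else follows once there are, for every [N] and
    [eps < N^-(1 - 1/p-star)], vectors [x_1, ..., x_N] in [B_X] satisfying
    [lower_l1 eps].

    If [p-star = 2] this is a Dvoretzky-Rogers argument: a linear map into
    Euclidean space that is dominated by the norm and almost maximises a
    determinant leaves room, in high dimension, for [N] vectors of [B_X] with almost
    orthonormal images.

    If [p-star < 2] and there are no such vectors for some [N], write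
    [eps = N^(-1/q)] with [q > 2]. The largest possible [lower_l1] constants are
    submultiplicative in the number of vectors, so every delta-shattered set
    has at most [N * delta^-q] points. By the combinatorial lemma of Alon,
    Ben-David, Cesa-Bianchi and Haussler, the dual ball restricted to [m] points
    has uniform delta-entropy [O (delta^-q)] up to logarithms, and chaining
    yields [E || sum e_i x_i || <= C m^(1 - 1/q) log^2 m]. Splitting arbitrary
    vectors into blocks of comparable norm, [X] has a type larger than
    [p-star], a contradiction. *)

From HB Require Import structures.
Require Import Defs.
From mathcomp Require Import all_boot all_order all_algebra.
From mathcomp Require Import all_classical all_reals all_analysis.
From mathcomp Require Import perm ring lra zify.

Set Implicit Arguments.
Unset Strict Implicit.
Unset Printing Implicit Defensive.

Import Order.TTheory GRing.Theory Num.Theory.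
Import numFieldNormedType.Exports.

Local Open Scope classical_set_scope.
Local Open Scope ring_scope.

(** * Extension of linear functionals *)

Section HahnBanach.
Context {R : realType} {X : lmodType R}.
Implicit Types (p q : X -> R) (x y : X).

Definition sublinear q :=
  (forall x y, q (x + y) <= q x + q y) /\
  (forall t x, 0 < t -> q (t *: x) <= t * q x).

Lemma sublinear0 q : sublinear q -> q 0 = 0.
Proof.
move=> [qD qZ]; apply/eqP; rewrite eq_le; apply/andP; split.
  have := qZ 2^-1 0; rewrite scaler0 invr_gt0 ltr0n => /(_ isT); lra.
by have := qD 0 0; rewrite addr0; lra.
Qed.

Lemma sublinear_opp q x : sublinear q -> - q (- x) <= q x.
Proof.
by move=> sq; have [qD _] := sq; have := qD x (- x); rewrite subrr sublinear0//; lra.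
Qed.

(** For a convex cone of pairs [(y, c)] with [c <= q y], let [q' x] be the infimum of
    [q (x + y) - c]. A linear functional below [q'] is then at least [c] at [y] for every pair of
    the cone. *)
Lemma sublinear_cone q (S : set (X * R)) : sublinear q ->
  S (0, 0) -> (forall a b, S a -> S b -> S (a + b)) ->
  (forall t a, 0 < t -> S a -> S (t *: a.1, t * a.2)) ->
  (forall a, S a -> a.2 <= q a.1) ->
  exists q', [/\ sublinear q', forall x, q' x <= q x &
    forall a, S a -> q' (- a.1) <= - a.2].
Proof.
move=> sq S0 SD SZ Sq; have [qD qZ] := sq.
pose E x := [set q (x + a.1) - a.2 | a in S].
have Elb x : has_lbound (E x).
  exists (- q (- x)) => _ [a Sa <-].
  have := qD (x + a.1) (- x); rewrite addrAC subrr add0r.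
  by have := Sq _ Sa; lra.
have E0 x : E x !=set0 by exists (q (x + 0) - 0), (0, 0).
have inf_le x a : S a -> inf (E x) <= q (x + a.1) - a.2.
  by move=> Sa; apply: ge_inf => //; exists a.
exists (fun x => inf (E x)); split.
- split=> [x y|t x t0].
  + rewrite -lerBlDl; apply: lb_le_inf => // _ [b Sb <-].
    rewrite lerBlDl -lerBlDr; apply: lb_le_inf => // _ [a Sa <-].
    have := inf_le (x + y) _ (SD _ _ Sa Sb).
    have := qD (x + a.1) (y + b.1); rewrite addrACA /=; lra.
  + rewrite mulrC -ler_pdivrMr//; apply: lb_le_inf => // _ [a Sa <-].
    rewrite ler_pdivrMr//; apply: (le_trans (inf_le _ _ (SZ t a t0 Sa))) => /=.
    by rewrite -scalerDr; have := qZ t (x + a.1) t0; lra.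
- by move=> x; have := inf_le x _ S0; rewrite /= addr0 subr0.
- by move=> a Sa; have := inf_le (- a.1) _ Sa; rewrite addNr sublinear0// sub0r.
Qed.

(* A minimal sublinear functional is linear. *)
Lemma sublinear_linear p : sublinear p ->
  exists2 f : X -> R, scalar f & forall x, f x <= p x.
Proof.
move=> sp; pose T := {q : X -> R | sublinear q /\ forall x, q x <= p x}.
pose mk q (h : sublinear q /\ forall x, q x <= p x) : T := exist _ q h.
(* The order is reversed: a maximal element in Zorn's lemma is a minimal sublinear functional. *)
pose le (r s : T) := `[< forall x, sval s x <= sval r x >].
have [|||q qmin] := @ZL_preorder T (mk p (conj sp (fun x => lexx _))) le.
- by move=> t; apply/asboolP.
- by move=> r s t /asboolP rs /asboolP st; apply/asboolP => x; exact: le_trans (st x) (rs x).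
- move=> A totA; have [[t0 At0]|A0] := pselect (A !=set0); last first.
    exists (mk p (conj sp (fun x => lexx _))) => s As.
    by exfalso; apply: A0; exists s.
  (* A nonempty chain is bounded by its pointwise infimum, finite because every member is at least
     [- p (- x)] at [x]. *)
  pose E x := [set sval t x | t in A].
  have Elb x : has_lbound (E x).
    exists (- p (- x)) => _ [[t [st tp]] At <-] /=.
    by have := sublinear_opp x st; have := tp (- x); lra.
  have E0 x : E x !=set0 by exists (sval t0 x), t0.
  have inf_le x t : A t -> inf (E x) <= sval t x.
    by move=> At; apply: ge_inf => //; exists t.
  have sE : sublinear (fun x => inf (E x)) /\ forall x, inf (E x) <= p x.
    split; last first.
      by move=> x; apply: le_trans (inf_le x _ At0) _; exact: (svalP t0).2.
    split=> [x y|t x t0'].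
    + rewrite -lerBlDl; apply: lb_le_inf => // _ [b Sb <-].
      rewrite lerBlDl -lerBlDr; apply: lb_le_inf => // _ [a Sa <-].
      have [/asboolP ab|/asboolP ba] := totA _ _ Sa Sb.
      * have := inf_le (x + y) _ Sb; have := (svalP b).1.1 x y.
        by have := ab x; lra.
      * have := inf_le (x + y) _ Sa; have := (svalP a).1.1 x y.
        by have := ba y; lra.
    + rewrite mulrC -ler_pdivrMr//; apply: lb_le_inf => // _ [a Sa <-].
      rewrite ler_pdivrMr//; apply: (le_trans (inf_le _ _ Sa)).
      by have := (svalP a).1.2 t x t0'; lra.
  exists (mk _ sE) => s As; apply/asboolP => x /=; exact: inf_le.
case: q qmin => q [sq qp] qmin; have [qD qZ] := sq.
have qZE t x : 0 < t -> q (t *: x) = t * q x.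
  move=> t0; apply/eqP; rewrite eq_le qZ//=.
  have := qZ t^-1 (t *: x); rewrite invr_gt0 => /(_ t0).
  by rewrite scalerA mulVf ?gt_eqF// scale1r ler_pdivlMl.
have qDE x y : q (x + y) = q x + q y.
  apply/eqP; rewrite eq_le qD/=.
  (* By minimality, the ray through [(y, q y)] forces [q (- y) <= - q y]; additivity then follows
     from subadditivity. *)
  pose S := [set a : X * R | exists2 t, 0 <= t & a = (t *: y, t * q y)].
  have [| | | | |q' [sq' q'q q'S]] := @sublinear_cone q S.
  - exact: sq.
  - by exists 0; rewrite ?scale0r ?mul0r.
  - move=> _ _ [t t0 ->] [u u0 ->]; exists (t + u); first exact: addr_ge0.
    by rewrite scalerDl mulrDl.
  - move=> t _ t0 [u u0 ->]; exists (t * u); first by rewrite mulr_ge0// ltW.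
    by rewrite /= scalerA mulrA.
  - move=> _ [t t0 ->] /=; move: t0; rewrite le_eqVlt => /predU1P[<-|t0].
      by rewrite scale0r mul0r sublinear0.
    by rewrite qZE.
  have q'p z : q' z <= p z by exact: le_trans (q'q z) (qp z).
  have /asboolP qq' := qmin (mk q' (conj sq' q'p))
    (introT (asboolP _) q'q).
  have : q' (- y) <= - q y by apply: (q'S (y, q y)); exists 1; rewrite ?scale1r ?mul1r.
  have := qq' (- y); have := qq' x; have := qD (x + y) (- y); rewrite addrK /=.
  lra.
have qN x : q (- x) = - q x.
  by have := qDE x (- x); rewrite subrr (sublinear0 sq); lra.
exists q => // a u v; rewrite qDE; congr (_ + _).
have [a0|a0|->] := ltrgt0P a; last by rewrite scale0r (sublinear0 sq) mul0r.
- by rewrite qZE.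
- by rewrite -[a *: u]opprK -scaleNr qN qZE ?oppr_gt0// mulNr opprK.
Qed.

End HahnBanach.

Definition contractive_functional {R : realType} {X : normedModType R} : set (X -> R) :=
  [set f | scalar f /\ forall x, `|f x| <= `|x|].

Section ContractiveFunctional.
Context {R : realType} {X : normedModType R}.
Implicit Types (f : X -> R).

Lemma sublinear_norm : sublinear (fun x : X => `|x|).
Proof.
by split=> [x y|t x t0]; [exact: ler_normD | rewrite normrZ gtr0_norm].
Qed.

(** The cone here is a subspace, so the one-sided inequalities from [sublinear_cone] apply to [x i]
    and to [- x i], which turns them into equalities. *)
Lemma helly_extension (I : finType) (x : I -> X) (c : I -> R) :
  (forall a : I -> R, \sum_i a i * c i <= `|\sum_i a i *: x i|) ->
  exists2 f, contractive_functional f & forall i, f (x i) = c i.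
Proof.
move=> xc.
pose S := [set u : X * R | exists a : I -> R,
  u = (\sum_i a i *: x i, \sum_i a i * c i)].
have [|||||q [sq qn qS]] := @sublinear_cone R X (fun x => `|x|) S.
- exact: sublinear_norm.
- by exists (fun=> 0); rewrite !big1// => i _; rewrite ?scale0r ?mul0r.
- move=> _ _ [a ->] [b ->]; exists (fun i => a i + b i).
  congr (_, _); rewrite -big_split; apply: eq_bigr => i _ /=.
    by rewrite scalerDl.
  by rewrite mulrDl.
- move=> t _ t0 [a ->]; exists (fun i => t * a i); rewrite /= scaler_sumr mulr_sumr.
  by congr (_, _); apply: eq_bigr => i _; rewrite ?scalerA ?mulrA.
- by move=> _ [a ->] /=.
have [f lf fq] := sublinear_linear sq.
have fN y : f (- y) = - f y.
  have := lf (-1) y 0; rewrite addr0 scaleN1r => ->.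
  have := lf 1 0 0; rewrite scale1r addr0; lra.
exists f.
  split=> // y; rewrite ler_norml; apply/andP; split.
    by rewrite lerNl -fN -[leRHS]normrN (le_trans (fq _)).
  by rewrite (le_trans (fq _)).
have fc (s : R) i : f (- (s *: x i)) <= - (s * c i).
  apply: le_trans (fq _) _; apply: (qS (s *: x i, s * c i)).
  exists (fun j => if j == i then s else 0).
  by congr (_, _); rewrite (bigD1 i)//= eqxx big1 ?addr0// => j /negPf ->;
    rewrite ?scale0r ?mul0r.
move=> i; apply/eqP; rewrite eq_le; apply/andP; split.
  by have := fc (-1) i; rewrite scaleN1r opprK mulN1r opprK.
by have := fc 1 i; rewrite scale1r mul1r fN lerN2.
Qed.

Lemma norming_functional (x : X) :
  exists2 f, contractive_functional f & f x = `|x|.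
Proof.
have [|f cf fx] := @helly_extension 'I_1 (fun=> x) (fun=> `|x|).
  move=> a; rewrite !big_ord1 normrZ; apply: ler_wpM2r => //; exact: ler_norm.
by exists f => //; exact: fx ord0.
Qed.

Lemma scalar0 f : scalar f -> f 0 = 0.
Proof. by move=> lf; have := lf 1 0 0; rewrite scale1r addr0; lra. Qed.

Lemma scalar_sum f (I : finType) (a : I -> R) (x : I -> X) : scalar f ->
  f (\sum_i a i *: x i) = \sum_i a i * f (x i).
Proof.
move=> lf; have f0 : f 0 = 0.
  by have := lf 1 0 0; rewrite scale1r addr0; lra.
elim/big_rec2: _ => // i u v _ <-; exact: lf.
Qed.

End ContractiveFunctional.

(** For the direct implication, continuity makes the supremum in [dual_norm] finite, and homogeneity
    carries the bound from unit vectors to all of [X]. *)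
Lemma dual_unit_ballP {R : realType} (X : completeNormedModType R) (f : X -> R) :
  dual_unit_ball X f <-> contractive_functional f.
Proof.
split=> [[lf cf nf]|[lf cf]]; last first.
  pose F : {linear X -> R} := HB.pack f (GRing.isLinear.Build _ _ _ _ f lf).
  split=> //.
    apply: (@bounded_linear_continuous _ _ _ F); apply/linear_boundedP.
    exists 1; split=> // r r1 x; apply: le_trans (cf x) _.
    by rewrite ler_peMl// ltW.
  apply: ge_sup; first by exists `|f 0|, 0; rewrite //= /unit_ball/= normr0.
  by move=> _ [x /= x1 <-]; exact: le_trans (cf x) x1.
pose F : {linear X -> R} := HB.pack f (GRing.isLinear.Build _ _ _ _ f lf).
have /linear_boundedP/pinfty_ex_gt0[M M0 MP] :=
  @continuous_linear_bounded _ _ _ 0 F (cf 0).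
split=> // x; have [->|x0] := eqVneq x 0; first by rewrite (linear0 F : f 0 = 0) !normr0.
have fZ : f (`|x|^-1 *: x) = `|x|^-1 * f x.
  by have := lf (`|x|^-1) x 0; rewrite (linear0 F : f 0 = 0) !addr0.
suff : `|f (`|x|^-1 *: x)| <= 1.
  by rewrite fZ normrM normfV normr_id [leLHS]mulrC ler_pdivrMr ?normr_gt0// mul1r.
apply: le_trans nf; apply: ub_le_sup; last first.
  exists (`|x|^-1 *: x) => //.
  by rewrite /unit_ball/= normrZ normfV normr_id mulVf// normr_eq0.
exists M => _ [y /= y1 <-]; apply: le_trans (MP y) _.
by rewrite -[leRHS]mulr1 ler_wpM2l// ltW.
Qed.

(** * Shattering and lower l1 estimates *)

Definition lower_l1 {R : realType} {X : normedModType R} (eps : R) (I : finType)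
    (x : I -> X) : Prop :=
  forall a : I -> R, eps * \sum_i `|a i| <= `|\sum_i a i *: x i|.

Section Shattering.
Context {R : realType} {X : normedModType R}.

(** Take [f] for the set where [a] is nonnegative and [g] for its complement. In [f - g] the levels
    [s] cancel, the [i]-th term is at least [2 * eps * |a i|], and the functional has norm at most
    2. *)
Lemma lower_l1_of_sign_patterns (I : finType) (x : I -> X) (s : I -> R) eps :
  (forall A : {set I}, exists2 f, contractive_functional f &
    (forall i, i \in A -> s i + eps <= f (x i)) /\
    (forall i, i \notin A -> f (x i) <= s i - eps)) ->
  lower_l1 eps x.
Proof.
move=> H a; have [f [lf cf] [fp fn]] := H [set i | 0 <= a i]%SET.
have [g [lg cg] [gp gn]] := H (~: [set i | 0 <= a i])%SET.
have : \sum_i a i * f (x i) - \sum_i a i * g (x i) <= 2 * `|\sum_i a i *: x i|.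
  rewrite -!scalar_sum// mulr_natl mulr2n; apply: le_trans (ler_norm _) _.
  by apply: le_trans (ler_normB _ _) _; exact: lerD.
rewrite -sumrB => h; rewrite -(ler_pM2l (ltr0n R 2)); apply: le_trans h.
rewrite !mulr_sumr; apply: ler_sum => i _.
have [a0|a0] := leP 0 (a i).
  have := fp i; have := gn i; rewrite !inE a0 => /(_ isT) h1 /(_ isT) h2.
  by rewrite ger0_norm//; nra.
have := fn i; have := gp i; rewrite !inE leNgt a0 /= => /(_ isT) h1 /(_ isT) h2.
by rewrite ltr0_norm//; nra.
Qed.

Lemma lower_l1_inj (I : finType) (x : I -> X) eps : 0 < eps ->
  lower_l1 eps x -> injective x.
Proof.
move=> e0 lx i j xij; apply/eqP; apply: contraT => ij.
have := lx (fun k => (k == i)%:R - (k == j)%:R).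
have -> : \sum_k ((k == i)%:R - (k == j)%:R) *: x k = 0 :> X.
  under eq_bigr do rewrite scalerBl.
  rewrite sumrB (bigD1 i)//= eqxx scale1r big1 ?addr0; last first.
    by move=> k /negPf ->; rewrite scale0r.
  rewrite (bigD1 j)//= eqxx scale1r big1 ?addr0 ?xij ?subrr//.
  by move=> k /negPf ->; rewrite scale0r.
rewrite normr0 leNgt mulr_gt0// (bigD1 i)//= eqxx (negPf ij) subr0 normr1.
by rewrite ltr_pwDl// sumr_ge0.
Qed.

(** For prescribed values [eps] and [- eps], the lower l1 estimate implies the hypothesis of
    [helly_extension]; all levels can therefore be 0. *)
Lemma sign_patterns_of_lower_l1 (I : finType) (x : I -> X) eps : 0 <= eps ->
  lower_l1 eps x -> forall A : {set I}, exists2 f, contractive_functional f &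
    forall i, f (x i) = if i \in A then eps else - eps.
Proof.
move=> e0 lx A; apply: helly_extension => a; apply: le_trans (lx a).
rewrite mulr_sumr; apply: ler_sum => i _.
rewrite (le_trans (ler_norm _))// normrM mulrC ler_wpM2r//.
by case: ifP; rewrite ?normrN ger0_norm.
Qed.

End Shattering.

Section VCLower.
Context {R : realType} {X : completeNormedModType R}.
Let VCX eps := VC eps (dual_unit_ball X) (unit_ball X).

Lemma VC_ge eps n (x : 'I_n -> X) : 0 < eps -> (forall i, `|x i| <= 1) ->
  lower_l1 eps x -> (n%:R%:E <= VCX eps)%E.
Proof.
move=> e0 x1 lx; apply: ereal_sup_ubound; exists n => //; exists x; split=> //.
  exact: lower_l1_inj lx.
exists (fun=> 0) => I.
have [f cf fx] := sign_patterns_of_lower_l1 (ltW e0) lx I.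
exists f; first exact/dual_unit_ballP.
split=> i; first by move=> iI; rewrite fx iI add0r.
by move=> /negPf iI; rewrite fx iI sub0r.
Qed.

Lemma VC_le eps (c : R) :
  (forall n (x : 'I_n -> X), (forall i, `|x i| <= 1) -> lower_l1 eps x -> n%:R <= c) ->
  (VCX eps <= c%:E)%E.
Proof.
move=> H; apply: ge_ereal_sup => _ [n [x [_ x1 [s sx]]] <-].
rewrite lee_fin; apply: (H n x) => //.
apply: (@lower_l1_of_sign_patterns _ _ _ _ (s \o x)) => I.
by have [f /dual_unit_ballP cf fx] := sx I; exists f.
Qed.

Lemma VC_ge0 eps : 0 < eps -> (0 <= VCX eps)%E.
Proof.
move=> e0; apply: (@VC_ge _ 0 (fun=> 0)) => // [[]//|a].
by rewrite !big_ord0 mulr0 normr0.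
Qed.

Lemma lower_l1_rademacher eps n (x : 'I_n -> X) : lower_l1 eps x ->
  eps * n%:R <= rademacher_mean x.
Proof.
move=> lx; rewrite /rademacher_mean -ler_pdivrMl ?invr_gt0 ?exprn_gt0// invrK.
have <- : \sum_(e : {ffun 'I_n -> bool}) (eps * n%:R) = 2 ^+ n * (eps * n%:R).
  by rewrite sumr_const card_ffun card_bool card_ord -[LHS]mulr_natl natrX.
apply: ler_sum => e _; apply: le_trans (lx _).
under eq_bigr do rewrite normrX normrN1 expr1n.
by rewrite sumr_const card_ord.
Qed.

End VCLower.

(** * Rademacher type *)

Lemma powR_natr_unbounded {R : realType} (s C : R) : 0 < s ->
  exists n : nat, C < n%:R `^ s.
Proof.
move=> s0; have := archi_boundP (powR_ge0 (`|C|) s^-1).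
set n := Num.Def.archi_bound _ => Cn; exists n.
apply: le_lt_trans (ler_norm C) _.
have -> : `|C| = (`|C| `^ s^-1) `^ s by rewrite -powRrM mulVf ?gt_eqF// powRr1.
by rewrite gt0_ltr_powR// nnegrE ?powR_ge0.
Qed.

Section SignSums.
Context {R : realType}.

Definition sign_sum n (e : {ffun 'I_n -> bool}) : R := \sum_(i < n) (-1) ^+ e i.

Definition cons_ffun n (be : bool * {ffun 'I_n -> bool}) : {ffun 'I_n.+1 -> bool} :=
  [ffun i => if unlift ord0 i is Some j then be.2 j else be.1].

Lemma big_cons_ffun n (G : {ffun 'I_n.+1 -> bool} -> R) :
  \sum_e G e = \sum_(e : {ffun 'I_n -> bool})
    (G (cons_ffun (false, e)) + G (cons_ffun (true, e))).
Proof.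
rewrite (reindex (@cons_ffun n)) /=.
  rewrite -(pair_big xpredT xpredT (fun b e => G (cons_ffun (b, e))))/=.
  by rewrite big_bool /= addrC -big_split.
exists (fun e : {ffun 'I_n.+1 -> bool} => (e ord0, [ffun j => e (lift ord0 j)])).
  move=> [b e] _; congr (_, _); first by rewrite ffunE unlift_none.
  by apply/ffunP => j; rewrite !ffunE liftK.
move=> e _; apply/ffunP => i; rewrite ffunE /=.
by case: unliftP => [j|] ->; rewrite ?ffunE.
Qed.

Lemma sign_sum_cons n b (e : {ffun 'I_n -> bool}) :
  sign_sum (cons_ffun (b, e)) = (-1) ^+ b + sign_sum e.
Proof.
rewrite /sign_sum big_ord_recl ffunE unlift_none; congr (_ + _).
by apply: eq_bigr => i _; rewrite ffunE liftK.
Qed.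

(** Summing over the first sign cancels odd powers and leaves [2 s^2 + 2] and [2 s^4 + 12 s^2 + 2],
    which gives both recursions. *)
Lemma sign_sum_sqr n : \sum_(e : {ffun 'I_n -> bool}) sign_sum e ^+ 2 = 2 ^+ n * n%:R :> R
  /\ \sum_(e : {ffun 'I_n -> bool}) sign_sum e ^+ 4 = 2 ^+ n * (3 * n%:R ^+ 2 - 2 * n%:R) :> R.
Proof.
elim: n => [|n [IH2 IH4]].
  split; rewrite ?mulr0 ?expr0n ?mulr0 ?subr0 ?mulr0; apply: big1 => e _;
  by rewrite /sign_sum big_ord0 expr0n.
have c1 : \sum_(e : {ffun 'I_n -> bool}) 1 = 2 ^+ n :> R.
  by rewrite sumr_const card_ffun card_bool card_ord natrX.
split; rewrite big_cons_ffun; under eq_bigr do rewrite !sign_sum_cons expr0 expr1.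
  rewrite [LHS](_ : _ = 2 * \sum_(e : {ffun 'I_n -> bool}) sign_sum e ^+ 2 +
      2 * \sum_(e : {ffun 'I_n -> bool}) 1); last first.
    by rewrite !mulr_sumr -big_split; apply: eq_bigr => e _ /=; ring.
  rewrite IH2 c1 (exprS 2 n) -(natr1 n); ring.
rewrite [LHS](_ : _ = 2 * \sum_(e : {ffun 'I_n -> bool}) sign_sum e ^+ 4 +
    12 * \sum_(e : {ffun 'I_n -> bool}) sign_sum e ^+ 2 +
    2 * \sum_(e : {ffun 'I_n -> bool}) 1); last first.
  by rewrite !mulr_sumr -!big_split; apply: eq_bigr => e _ /=; ring.
by rewrite IH2 IH4 c1 (exprS 2 n) -(natr1 n); ring.
Qed.

(* Khinchine's inequality through [2 u >= 3 u ^ 2 - u ^ 4] for [u >= 0], with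
   [u] the sign sum divided by [2 m]. *)
Lemma sign_sum_lower m : (0 < m)%N ->
  2 ^+ (2 * m ^ 2) * (3 / 4 * m%:R)
    <= \sum_(e : {ffun 'I_(2 * m ^ 2) -> bool}) `|sign_sum e| :> R.
Proof.
move=> m0; have m0' : 0 < m%:R :> R by rewrite ltr0n.
have [S2 S4] := sign_sum_sqr (2 * m ^ 2).
set n := (2 * m ^ 2)%N in S2 S4 *.
have nm : n%:R = 2 * m%:R ^+ 2 :> R by rewrite natrM natrX.
have H (s : R) : 3 / (4 * m%:R) * s ^+ 2 - s ^+ 4 / (16 * m%:R ^+ 3) <= `|s|.
  have -> : s ^+ 2 = `|s| ^+ 2 by rewrite real_normK ?num_real.
  have -> : s ^+ 4 = `|s| ^+ 4 by rewrite !(exprM _ 2 2) real_normK ?num_real.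
  pose u := `|s| / (2 * m%:R); have u0 : 0 <= u by rewrite divr_ge0// mulr_ge0// ltW.
  have -> : `|s| = u * (2 * m%:R) by rewrite /u divfK// gt_eqF// mulr_gt0.
  rewrite -subr_ge0 (_ : _ - _ = m%:R * (u * (u - 1) ^+ 2 * (u + 2))).
    apply: mulr_ge0; first exact: ltW.
    by apply: mulr_ge0; [apply: mulr_ge0; rewrite // sqr_ge0|lra].
  by field; rewrite gt_eqF.
have : \sum_(e : {ffun 'I_n -> bool}) (3 / (4 * m%:R) * sign_sum e ^+ 2
    - sign_sum e ^+ 4 / (16 * m%:R ^+ 3)) <= \sum_(e : {ffun 'I_n -> bool}) `|sign_sum e|.
  by apply: ler_sum => e _; exact: H.
apply: le_trans; rewrite sumrB -mulr_sumr -mulr_suml S2 S4 nm.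
set P := 2 ^+ n; have P0 : 0 < P :> R by rewrite exprn_gt0.
rewrite -subr_ge0 (_ : _ - _ = P * (4 * m%:R ^+ 2) / (16 * m%:R ^+ 3)).
  by rewrite divr_ge0 ?mulr_ge0// ?ltW// ?exprn_gt0.
by field; rewrite gt_eqF.
Qed.

End SignSums.

Section RademacherType.
Context {R : realType} {X : completeNormedModType R}.
Implicit Types (p C eps : R).

Lemma infinite_dimensional_neq0 : infinite_dimensional X -> exists x : X, x != 0.
Proof.
move=> dimX; apply: contrapT => X0; apply: dimX; exists 0%N, (fun=> 0) => x.
exists (fun=> 0); rewrite big_ord0; apply/eqP; apply: contrapT => x0.
by apply: X0; exists x; apply/negP.
Qed.

Lemma rademacher_mean_ge0 n (x : 'I_n -> X) : 0 <= rademacher_mean x.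
Proof. by rewrite mulr_ge0 ?invr_ge0 ?exprn_ge0// sumr_ge0. Qed.

Lemma type_bound_ge0 (x0 : X) p C : x0 != 0 -> type_bound X p C -> 0 <= C.
Proof.
move=> x00 /(_ 1 (fun=> x0)) /(le_trans (rademacher_mean_ge0 _)).
by rewrite big_ord1 pmulr_lge0// !powR_gt0// normr_gt0.
Qed.

(** The infimum is itself admissible: for a fixed family with nonzero right-hand side, the quotient
    of the two sides bounds all admissible constants from below. *)
Lemma type_constantP (x0 : X) p : x0 != 0 -> has_type X p ->
  type_bound X p (type_constant X p).
Proof.
move=> x00 [p1 [C0 HC0]] n x.
set S := (X in _ <= _ * X); have : 0 <= S by exact: powR_ge0.
rewrite le_eqVlt => /predU1P[S0|S0].
  by have := HC0 n x; rewrite -/S -S0 !mulr0.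
rewrite -ler_pdivrMr//; apply: lb_le_inf; first by exists C0.
by move=> C HC; rewrite ler_pdivrMr//; exact: HC.
Qed.

Lemma norm_sign_sum (I : finType) (x : I -> X) (e : {ffun I -> bool}) :
  `|\sum_i (-1) ^+ e i *: x i| <= \sum_i `|x i|.
Proof.
apply: le_trans (ler_norm_sum _ _ _) _; apply: ler_sum => i _.
by rewrite normrZ normrX normrN1 expr1n mul1r.
Qed.

Lemma has_type1 : has_type X 1.
Proof.
split=> //; exists 1 => n x; rewrite invr1 mul1r powRr1; last first.
  by apply: sumr_ge0 => i _; exact: powR_ge0.
under [leRHS]eq_bigr do rewrite powRr1//.
rewrite /rademacher_mean ler_pdivrMl ?exprn_gt0//.
rewrite -[2 ^+ n * _](_ : \sum_(e : {ffun 'I_n -> bool}) \sum_i `|x i| = _).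
  by apply: ler_sum => e _; exact: norm_sign_sum.
by rewrite sumr_const card_ffun card_bool card_ord -[LHS]mulr_natl natrX.
Qed.

(** Test type [p] on [2 m^2] copies of [x0]. The mean is at least [3/4 m |x0|], against the bound
    [C (2 m^2)^(1/p) |x0|], which is smaller for large [m] when [p > 2]. *)
Lemma has_type_le2 (x0 : X) p : x0 != 0 -> has_type X p -> p <= 2.
Proof.
move=> x00 [p1 [C HC]]; rewrite leNgt; apply/negP => p2.
have p0 : 0 < p by lra.
have C0 := type_bound_ge0 x00 HC.
have nx0 : 0 < `|x0| by rewrite normr_gt0.
have s0 : 0 < 1 - 2 * p^-1 by rewrite subr_gt0 ltr_pdivrMr// mul1r.
have [m] := powR_natr_unbounded (4 / 3 * C * 2 `^ p^-1) s0.
apply/negP; rewrite -leNgt.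
have [->|m0] := posnP m.
  by rewrite powR0 ?gt_eqF// !mulr_ge0// powR_ge0.
have m0' : 0 < m%:R :> R by rewrite ltr0n.
have := HC (2 * m ^ 2)%N (fun=> x0); rewrite /rademacher_mean.
under eq_bigr do rewrite -scaler_suml normrZ.
rewrite -mulr_suml; set n := (2 * m ^ 2)%N.
rewrite sumr_const card_ord -[_ *+ n]mulr_natl powRM ?powR_ge0//.
rewrite -powRrM mulfV ?gt_eqF// powRr1// !mulrA ler_pM2r//.
have := @sign_sum_lower R m m0; rewrite -/n -ler_pdivlMl ?exprn_gt0// /sign_sum.
move=> /le_trans h /h{h}.
rewrite natrM natrX powRM ?exprn_ge0 ?ler0n// -powR_mulrn ?ler0n// -powRrM.
set A := 2 `^ p^-1; set B := _ `^ (_ * _) => H.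
have -> : m%:R `^ (1 - 2 * p^-1) = m%:R / B.
  by rewrite powRB ?(gt_eqF m0') ?implybT// powRr1// ltW.
have B0 : 0 < B by rewrite powR_gt0.
by rewrite ler_pdivrMr//; lra.
Qed.

Section TypeSup.
Variables (x0 : X) (x00 : x0 != 0).

Let has_sup_type : has_sup [set p | has_type X p].
Proof.
split; first by exists 1; exact: has_type1.
by exists 2 => p; exact: has_type_le2 x00.
Qed.

Lemma has_type_le_sup p : has_type X p -> p <= type_sup X.
Proof. by move=> Hp; apply: ub_le_sup => //; case: has_sup_type. Qed.

Lemma type_sup_ge1 : 1 <= type_sup X.
Proof. exact: has_type_le_sup has_type1. Qed.

Lemma type_sup_le2 : type_sup X <= 2.
Proof.
by apply: ge_sup => [|p]; [case: has_sup_type | exact: has_type_le2 x00].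
Qed.

Lemma lt_type_sup r : r < type_sup X -> exists2 p, r < p & has_type X p.
Proof.
rewrite -subr_gt0 => /sup_adherent /(_ has_sup_type)[p Hp].
by rewrite opprB addrC subrK => rp; exists p.
Qed.

End TypeSup.

(** Averaging over signs gives [eps n <= C n^(1/p)]; raise [n^(1 - 1/p) <= C / eps] to the conjugate
    exponent of [p]. *)
Lemma lower_l1_card_le p C eps n (x : 'I_n -> X) : 1 < p -> 0 <= C -> 0 < eps ->
  type_bound X p C -> (forall i, `|x i| <= 1) -> lower_l1 eps x ->
  n%:R <= (C / eps) `^ (p / (p - 1)).
Proof.
move=> p1 C0 e0 HC x1 lx; have [->|n0] := posnP n; first exact: powR_ge0.
have n0' : 0 < n%:R :> R by rewrite ltr0n.
have p0 : 0 < p by lra.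
have := le_trans (lower_l1_rademacher lx) (HC n x).
have : (\sum_(i < n) `|x i| `^ p) `^ p^-1 <= n%:R `^ p^-1.
  apply: ge0_ler_powR; rewrite ?invr_ge0 ?nnegrE ?(ltW p0)//.
    by apply: sumr_ge0 => i _; exact: powR_ge0.
  rewrite -[leRHS](_ : \sum_(i < n) 1 = _); last by rewrite sumr_const card_ord.
  apply: ler_sum => i _; rewrite -(powRr0 `|x i|).
  have [->|xi0] := eqVneq (x i) 0; first by rewrite normr0 powR0 ?gt_eqF// powR_ge0.
  by apply: ger_powR; rewrite ?normr_gt0 ?xi0 ?x1// ltW.
move=> /(ler_wpM2l C0) h1 /le_trans /(_ h1){h1}.
set B := _ `^ _ => h.
have B0 : 0 < B by rewrite powR_gt0.
have : n%:R `^ (1 - p^-1) <= C / eps.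
  rewrite powRB ?(gt_eqF n0') ?implybT// powRr1 ?(ltW n0')// -/B.
  by rewrite ler_pdivrMr// mulrAC ler_pdivlMr// mulrC.
have pq : (1 - p^-1) * (p / (p - 1)) = 1.
  by field; rewrite !gt_eqF// subr_gt0.
have q0 : 0 <= p / (p - 1) by rewrite divr_ge0 ?subr_ge0 ?(ltW p0) ?(ltW p1).
move=> /(ge0_ler_powR q0); rewrite -powRrM pq powRr1 ?(ltW n0')//; apply.
  by rewrite nnegrE powR_ge0.
by rewrite nnegrE divr_ge0// ltW.
Qed.

End RademacherType.

(** * Submultiplicativity *)

Section Submultiplicativity.
Context {R : realType} {X : normedModType R}.
Implicit Types (eps delta : R).

Lemma lower_l1_comp (I J : finType) (h : J -> I) (x : I -> X) eps :
  injective h -> lower_l1 eps x -> lower_l1 eps (x \o h).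
Proof.
(* [b] extends [a] by zero along [h]; a sum over the fibre, which has at most one element, serves as
   the inverse of [h]. *)
move=> hI lx a; pose b i := \sum_(j | h j == i) a j.
have bh j : b (h j) = a j.
  rewrite /b (bigD1 j)//= big1 ?addr0// => k /andP[/eqP/hI ->].
  by rewrite eqxx.
have E (V : nmodType) (G : I -> V) : (forall i, i \notin codom h -> G i = 0) ->
    \sum_i G i = \sum_j G (h j).
  move=> G0; rewrite [RHS](partition_big h xpredT)//=; apply: eq_bigr => i _.
  have [/codomP[j ->]|iN] := boolP (i \in codom h).
    rewrite (bigD1 j)//= big1 ?addr0// => k /andP[/eqP/hI ->].
    by rewrite eqxx.
  by rewrite G0// big_pred0// => j; apply: contraNF iN => /eqP <-; exact: codom_f.
have b0 i : i \notin codom h -> b i = 0.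
  by move=> iN; rewrite /b big_pred0// => j; apply: contraNF iN => /eqP <-; exact: codom_f.
have := lx b; rewrite !E; first
  by under eq_bigr do rewrite bh; under [X in _ <= `|X|]eq_bigr do rewrite bh.
  by move=> i /b0 ->; rewrite scale0r.
by move=> i /b0 ->; rewrite normr0.
Qed.

Section Product.
Variables (N : nat) (eps : R).
Hypothesis eps0 : 0 < eps.
Hypothesis Nsmall : forall x : 'I_N -> X, (forall i, `|x i| <= 1) -> ~ lower_l1 eps x.

Lemma small_combination (x : 'I_N -> X) : (forall i, `|x i| <= 1) ->
  exists2 a : 'I_N -> R, \sum_i `|a i| = 1 & `|\sum_i a i *: x i| <= eps.
Proof.
move=> /Nsmall /existsNP[a /negP]; rewrite -ltNge => ax.
have sa0 : 0 < \sum_i `|a i|.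
  by rewrite -(pmulr_rgt0 _ eps0); apply: le_lt_trans ax.
set s := \sum_i `|a i| in ax sa0.
exists (fun i => s^-1 * a i).
  under eq_bigr do rewrite normrM gtr0_norm ?invr_gt0//.
  by rewrite -mulr_sumr mulVf// gt_eqF.
under eq_bigr do rewrite -scalerA.
rewrite -scaler_sumr normrZ gtr0_norm ?invr_gt0// ler_pdivrMl// mulrC.
exact: ltW.
Qed.

(** An index set of size [N ^ k], recursive so that a system on [blocks k.+1] is a family of
    [N]-tuples indexed by [blocks k]. *)
Fixpoint blocks k : finType :=
  if k is k'.+1 then ('I_N * blocks k')%type else unit.

Lemma card_blocks k : #|blocks k| = (N ^ k)%N.
Proof. by elim: k => [|k IH]; rewrite ?card_unit// card_prod card_ord IH expnS. Qed.

(* Normalised short combinations of the blocks form a new system in the ball. *)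
Lemma lower_l1_blocks k (x : blocks k -> X) delta : (forall i, `|x i| <= 1) ->
  lower_l1 delta x -> delta <= eps ^+ k.
Proof.
elim: k x delta => [|k IH] x delta x1 lx.
  have := lx (fun=> 1); rewrite sumr_const card_unit normr1 mulr1.
  rewrite (big_pred1 tt); last by case.
  by rewrite scale1r => /le_trans; apply; exact: x1.
have /choice[a Ha] j : exists a : 'I_N -> R,
    \sum_i `|a i| = 1 /\ `|\sum_i a i *: x (i, j)| <= eps.
  by have [|a] := @small_combination (fun i => x (i, j)); [|exists a].
pose y j := eps^-1 *: \sum_i a j i *: x (i, j).
have y1 j : `|y j| <= 1.
  rewrite normrZ gtr0_norm ?invr_gt0// ler_pdivrMl// mulr1.
  exact: (Ha j).2.
rewrite exprS mulrC -ler_pdivrMr//; apply: (IH y _ y1) => b.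
(* Since each [a j] has l1 norm 1, these product coefficients have the l1 norm of [b]; the vector
   they produce carries the factor [eps] removed from [y]. *)
have := lx (fun ij => b ij.2 * a ij.2 ij.1).
have -> : \sum_ij `|b ij.2 * a ij.2 ij.1| = \sum_j `|b j|.
  rewrite -(pair_big xpredT xpredT (fun i j => `|b j * a j i|))/= exchange_big/=.
  apply: eq_bigr => j _; under eq_bigr do rewrite normrM.
  by rewrite -mulr_sumr (Ha j).1 mulr1.
have -> : \sum_ij (b ij.2 * a ij.2 ij.1) *: x ij = eps *: \sum_j b j *: y j.
  rewrite (eq_bigr (fun ij => (b ij.2 * a ij.2 ij.1) *: x (ij.1, ij.2))); last by case.
  rewrite -(pair_big xpredT xpredT (fun i j => (b j * a j i) *: x (i, j)))/=.
  rewrite exchange_big/= scaler_sumr; apply: eq_bigr => j _.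
  rewrite scalerA mulrC -scalerA [eps *: _]scalerA mulfV ?gt_eqF// scale1r scaler_sumr.
  by apply: eq_bigr => i _; rewrite scalerA.
by rewrite normrZ gtr0_norm// mulrAC ler_pdivrMr// mulrC [in leRHS]mulrC.
Qed.

End Product.

End Submultiplicativity.

(** * Separated families and shattering *)

Section FatShattering.
Variables (I T : finType) (b : nat) (v : T -> I -> 'I_b).
Implicit Types (S : {set T}) (g : {ffun I -> option 'I_b}).

(* The partial function [g] records a shattered subset of [I] (its domain)
   together with the levels witnessing the shattering. *)
Definition strongly_shattered S g := [forall A : {set I}, [exists t in S,
  [forall i, if g i is Some s then
     (if i \in A then s < v t i else v t i < s)%N else true]]].

(** The gap of two levels leaves room for a level strictly in between, as strict shattering
    requires. *)
Definition separated S := forall t u, t \in S -> u \in S -> t != u ->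
  exists i, ((v t i).+1 < v u i)%N \/ ((v u i).+1 < v t i)%N.

Lemma strongly_shatteredP S g :
  reflect (forall A : {set I}, exists2 t, t \in S & forall i s, g i = Some s ->
    if i \in A then (s < v t i)%N else (v t i < s)%N)
  (strongly_shattered S g).
Proof.
apply: (iffP forallP) => H A.
  have /existsP[t /andP[tS /forallP Ht]] := H A; exists t => // i s gi.
  by have := Ht i; rewrite gi.
have [t tS Ht] := H A; apply/existsP; exists t; rewrite tS /=.
by apply/forallP => i; case gi: (g i) => [s|]//; exact: Ht.
Qed.

Lemma strongly_shattered_const S g i c :
  {in S, forall t, v t i = c} -> strongly_shattered S g -> g i = None.
Proof.
move=> vc /strongly_shatteredP sg; case gi: (g i) => [s|]//; exfalso.
have [t tS /(_ _ _ gi)] := sg finset.setT; have [u uS /(_ _ _ gi)] := sg finset.set0.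
by rewrite !inE !vc// => h1 h2; have := ltn_trans h1 h2; rewrite ltnn.
Qed.

Lemma strongly_shattered_sub S S' g : S \subset S' ->
  strongly_shattered S g -> strongly_shattered S' g.
Proof.
move=> SS' /strongly_shatteredP H; apply/strongly_shatteredP => A.
by have [t tS Ht] := H A; exists t => //; exact: (fintype.subsetP SS').
Qed.

Lemma separated_sub S S' : S \subset S' -> separated S' -> separated S.
Proof. by move=> /fintype.subsetP SS' H t u /SS' tS /SS' uS; exact: H. Qed.

(** The pairs are the entries [2 j] and [2 j + 1] of an enumeration of [S]; when [#|S|] is odd, one
    element stays unpaired. *)
Lemma disjoint_pairs S : exists P : bool -> 'I_(#|S|./2) -> T,
  (forall c j, P c j \in S) /\
  (forall c j c' j', P c j = P c' j' -> c = c' /\ j = j').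
Proof.
have [S0|[t0 _]] := set_0Vmem S.
  have h0 : #|S|./2 = 0%N by rewrite S0 cards0.
  rewrite h0; exists (fun _ (j : 'I_0) => False_rect T (let: Ordinal _ h := j in notF h)).
  by split=> [c []|c []].
have lt2 (c : bool) (j : 'I_(#|S|./2)) : (j.*2 + c < size (enum S))%N.
  rewrite -cardE; apply: leq_trans (_ : (#|S|./2).*2 <= _)%N; last first.
    by rewrite -[leqRHS]odd_double_half leq_addl.
  by have := ltn_ord j; case: c; lia.
exists (fun c j => nth t0 (enum S) (j.*2 + c)%N); split=> [c j|c j c' j' /eqP].
  by rewrite -mem_enum mem_nth.
rewrite nth_uniq ?enum_uniq// => /eqP jj'.
have cc' : c = c' by have := congr1 odd jj'; rewrite !oddD !odd_double !oddb.
split=> //; apply: val_inj => /=; move: jj'; rewrite cc' => /addIn /eqP.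
by rewrite -!muln2 eqn_pmul2r// => /eqP.
Qed.

Lemma pigeonhole (J L : finType) (f : J -> L) m : (#|L| * m <= #|J|)%N ->
  (0 < m)%N -> (0 < #|L|)%N -> exists l, (m <= #|[set j | f j == l]%SET|)%N.
Proof.
move=> LJ m0 L0; apply/existsP; rewrite -[[exists _, _]]negbK negb_exists.
apply/negP => /forallP H.
have : (#|J| <= #|L| * m.-1)%N.
  rewrite -sum1_card (partition_big f xpredT)//= -sum_nat_const.
  apply: leq_sum => l _; rewrite sum1dep_card -ltnS prednK//.
  by have := H l; rewrite -ltnNge.
have : (#|L| * m.-1 < #|L| * m)%N by rewrite ltn_pmul2l// prednK.
by move=> h1 h2; have := leq_trans (leq_ltn_trans h2 h1) LJ; rewrite ltnn.
Qed.

(* Split [S] into pairs. By pigeonhole many pairs share a coordinate [i0] and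
   the two values taken there; a [g] shattered by both the upper and the lower
   members of these pairs is also shattered by [S] after adding [i0]. *)
Lemma strongly_shattered_count k S (M := (#|I| * (b * b))%N) : (0 < M)%N ->
  separated S -> ((2 * M) ^ k <= #|S|)%N ->
  (2 ^ k <= #|[set g | strongly_shattered S g]%SET|)%N.
Proof.
move=> M0; elim: k S => [|k IH] S sepS cS.
  have /card_gt0P[t tS] : (0 < #|S|)%N by exact: leq_trans cS.
  apply/card_gt0P; exists [ffun=> None]; rewrite inE.
  by apply/strongly_shatteredP => A; exists t => // i s; rewrite ffunE.
have [P [PS Pinj]] := disjoint_pairs S.
have /choice[L HL] (j : 'I_(#|S|./2)) : exists l : bool * (I * ('I_b * 'I_b)),
    let: (c, (i, (u, w))) := l in
    [/\ v (P c j) i = u, v (P (~~ c) j) i = w & (w.+1 < u)%N].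
  have [|i [lt|lt]] := sepS (P true j) (P false j) (PS _ _) (PS _ _).
  - by apply/eqP => /Pinj[].
  - by exists (false, (i, (v (P false j) i, v (P true j) i))).
  - by exists (true, (i, (v (P true j) i, v (P false j) i))).
have [] := @pigeonhole 'I_(#|S|./2) (I * ('I_b * 'I_b))%type (fun j => (L j).2)
    ((2 * M) ^ k).
- rewrite card_ord !card_prod !card_ord -/M -[leqLHS]doubleK half_leq//.
  by rewrite -mul2n mulnA -expnS.
- by rewrite expn_gt0 muln_gt0 M0.
- by rewrite !card_prod !card_ord.
move=> [i0 [u w]]; set C := [set _ | _]%SET => cC.
(* The Boolean in the label of a pair orients it: [t false] picks the member with the larger value
   [u], [t true] the one with [w]. *)
pose t c j := P (c (+) (L j).1) j.
have tinj c : injective (t c) by move=> j j' /Pinj[].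
have tC c j : j \in C -> v (t c j) i0 = if c then w else u.
  rewrite inE /t; have := HL j; case: (L j) => [d [i [u' w']]] /= [h1 h2 _].
  by move=> /eqP[<- <- <-]; case: c.
have [j0 j0C] : exists j, j \in C.
  by apply/card_gt0P; apply: leq_trans cC; rewrite expn_gt0 muln_gt0 M0.
have wu : (w.+1 < u)%N.
  by move: j0C; rewrite inE; have := HL j0;
    case: (L j0) => [d [i [u' w']]] /= [_ _ lt] /eqP[_ <- <-].
pose F c := [set t c j | j in C]%SET.
have FS c : F c \subset S by apply/fintype.subsetP => _ /imsetP[j _ ->]; exact: PS.
have Fi0 c : {in F c, forall x, v x i0 = if c then w else u}.
  by move=> _ /imsetP[j jC ->]; exact: tC.
pose G c := [set g | strongly_shattered (F c) g]%SET.
have cG c : (2 ^ k <= #|G c|)%N.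
  apply: IH; first exact: separated_sub (FS c) sepS.
  by rewrite card_imset// ; exact: tinj.
have Gi0 c g : g \in G c -> g i0 = None.
  by rewrite inE; exact: strongly_shattered_const (Fi0 c).
(* The level [w + 1], strictly between [w] and [u]. *)
pose m : 'I_b := Ordinal (ltn_trans wu (ltn_ord u)).
pose ext g : {ffun I -> option 'I_b} := [ffun i => if i == i0 then Some m else g i].
pose GI := ext @: (G false :&: G true).
have extinj : {in G false :&: G true &, injective ext}.
  move=> g h; rewrite !finset.in_setI => /andP[gG _] /andP[hG _] /ffunP gh.
  apply/ffunP => i; have := gh i; rewrite !ffunE.
  by case: eqP => // -> _; rewrite (Gi0 _ _ gG) (Gi0 _ _ hG).
have GIU : (GI :&: (G false :|: G true))%SET = finset.set0.
  apply/finset.setP => h; rewrite finset.in_set0 finset.in_setI finset.in_setU.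
  apply/negP => /andP[/imsetP[g _ ->]].
  by move=> /orP[] /Gi0; rewrite ffunE eqxx.
have sub : GI :|: (G false :|: G true) \subset [set g | strongly_shattered S g]%SET.
  apply/fintype.subsetP => h; rewrite finset.in_setU => /orP[/imsetP[g gG ->]|]; last first.
    by rewrite finset.in_setU => /orP[]; rewrite !inE; exact: strongly_shattered_sub.
  move: gG; rewrite finset.in_setI !inE => /andP[/strongly_shatteredP g0 /strongly_shatteredP g1].
  apply/strongly_shatteredP => A; have [iA|iA] := boolP (i0 \in A).
    have [x xF Hx] := g0 A; exists x; first exact: (fintype.subsetP (FS false)).
    move=> i s; rewrite ffunE; case: eqP => [-> [<-]|_]; last exact: Hx.
    by rewrite iA (Fi0 false).
  have [x xF Hx] := g1 A; exists x; first exact: (fintype.subsetP (FS true)).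
  move=> i s; rewrite ffunE; case: eqP => [-> [<-]|_]; last exact: Hx.
  by rewrite (negPf iA) (Fi0 true)//=.
(* Patterns in [G] are undefined at [i0] and extended ones are not, so the count is
   [|G0 :&: G1| + |G0 :|: G1| = |G0| + |G1|], at least twice [2 ^ k]. *)
apply: leq_trans (subset_leq_card sub).
rewrite cardsU GIU cards0 subn0 card_in_imset//.
by rewrite addnC cardsUI expnS mul2n -addnn leq_add.
Qed.

Definition domain g := [set i | g i != None]%SET.

Lemma mem_domain g i : (i \in domain g) = (g i != None).
Proof. by rewrite inE. Qed.

(** Such a partial function is decoded from [d] optional pairs of a coordinate and a level. *)
Lemma card_small_domain d :
  (#|[set g | #|domain g| <= d]%SET| <= (#|I| * b).+1 ^ d)%N.
Proof.
pose dec (phi : {ffun 'I_d -> option (I * 'I_b)}) : {ffun I -> option 'I_b} :=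
  [ffun i => [pick s | [exists j, phi j == Some (i, s)]]].
have -> : ((#|I| * b).+1 ^ d)%N = #|{: {ffun 'I_d -> option (I * 'I_b)}}|.
  by rewrite card_ffun card_option card_prod !card_ord.
apply: leq_trans (leq_imset_card dec _); apply/subset_leq_card/fintype.subsetP => g.
rewrite inE => gd; apply/imsetP.
have [i0|I0] := pickP (@predT I); last first.
  by exists [ffun=> None] => //; apply/ffunP => i; have := I0 i.
exists [ffun j : 'I_d => let i := nth i0 (enum (domain g)) j in
  if i \in domain g then omap (pair i) (g i) else None] => //.
apply/ffunP => l; rewrite ffunE; case: pickP => [s /existsP[j]|].
  rewrite ffunE /=; case: ifP => // _; case gl: (g _) => [s'|]//= /eqP[<- <-].
  by rewrite gl.
move=> H; case gl: (g l) => [s|]//.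
have lg : l \in domain g by rewrite inE gl.
have ltd : (index l (enum (domain g)) < d)%N.
  by apply: leq_trans gd; rewrite cardE index_mem mem_enum.
have := H s; rewrite (_ : [exists _, _] = true)//.
by apply/existsP; exists (Ordinal ltd); rewrite ffunE /= nth_index ?mem_enum// lg gl.
Qed.

(** A larger family would strongly shatter at least [2 ^ k] patterns, more than there are with
    domain of size at most [d]. Taking [k] of order [d log (|I| b)] gives the entropy bound. *)
Lemma separated_card_lt d k S (M := (#|I| * (b * b))%N) : (0 < M)%N ->
  separated S -> (forall g, strongly_shattered S g -> #|domain g| <= d)%N ->
  ((#|I| * b).+1 ^ d < 2 ^ k)%N -> (#|S| < (2 * M) ^ k)%N.
Proof.
move=> M0 sepS Sd dk; rewrite ltnNge; apply/negP => /(strongly_shattered_count M0 sepS).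
apply/negP; rewrite -ltnNge; apply: leq_ltn_trans dk.
apply: leq_trans (card_small_domain d); apply/subset_leq_card/fintype.subsetP => g.
by rewrite !inE; exact: Sd.
Qed.

End FatShattering.

(** * Chaining *)

Section Chaining.
Context {R : realType} {n : nat}.
Implicit Types (G : {ffun 'I_n -> bool} -> R) (w : 'I_n -> R).

Definition rexp G : R := (2 ^+ n)^-1 * \sum_e G e.

Lemma le_rexp G1 G2 : (forall e, G1 e <= G2 e) -> rexp G1 <= rexp G2.
Proof.
by move=> G12; rewrite ler_wpM2l ?invr_ge0 ?exprn_ge0//; exact: ler_sum.
Qed.

Lemma rexp_cst (c : R) : rexp (fun=> c) = c.
Proof.
rewrite /rexp sumr_const card_ffun card_bool card_ord -[c *+ _]mulr_natl natrX.
by rewrite mulKf// gt_eqF// exprn_gt0.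
Qed.

Lemma rexpD G1 G2 : rexp (fun e => G1 e + G2 e) = rexp G1 + rexp G2.
Proof. by rewrite /rexp big_split mulrDr. Qed.

Lemma rexpZ (c : R) G : rexp (fun e => c * G e) = c * rexp G.
Proof. by rewrite /rexp -mulr_sumr mulrCA. Qed.

Lemma rexp_sum (K : finType) (P : pred K) (G : K -> {ffun 'I_n -> bool} -> R) :
  rexp (fun e => \sum_(k | P k) G k e) = \sum_(k | P k) rexp (G k).
Proof. by rewrite /rexp exchange_big/= mulr_sumr. Qed.

Definition pairing w (e : {ffun 'I_n -> bool}) : R := \sum_i (-1) ^+ e i * w i.

Lemma expR_half_le2 : expR 2^-1 <= 2 :> R.
Proof.
have := @expR_ge1Dx R (- 2^-1); rewrite expRN.
rewrite -[leRHS]div1r ler_pdivlMr ?expR_gt0//; lra.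
Qed.

(** A sub-Gaussian bound with a generous constant. For [x > 1/2] it follows from [x <= 2 x^2]; for
    smaller [x] write the left side as [2 + (h - 1/h)^2] with [h = exp (x/2)]. *)
Lemma cosh_le (x : R) : expR x + expR (- x) <= 2 * expR (2 * x ^+ 2).
Proof.
wlog x0 : x / 0 <= x.
  move=> H; have [|/ltW x0] := leP 0 x; first exact: H.
  by have := H (- x); rewrite opprK sqrrN oppr_ge0 addrC; exact.
have [x12|x12] := leP x 2^-1; last first.
  have : expR x <= expR (2 * x ^+ 2) by rewrite ler_expR; nra.
  have : expR (- x) <= expR x by rewrite ler_expR; lra.
  lra.
have := @expR_ge1Dx R (2 * x ^+ 2).
have : expR x <= 2 by apply: le_trans expR_half_le2; rewrite ler_expR.
set h := expR (x / 2); have xh : expR x = h ^+ 2.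
  by rewrite /h expr2 -expRD -splitr.
have xh' : expR (- x) = h^-1 ^+ 2.
  by rewrite /h -expRN expr2 -expRD -opprD -splitr.
have h0 : 0 < h by exact: expR_gt0.
have h1 : 1 <= h by rewrite -(expR0 R) ler_expR; lra.
(* [h - 1 / h = h (1 - exp (- x)) <= h x] *)
have : 1 - x <= h^-1 ^+ 2 by rewrite -xh'; exact: expR_ge1Dx.
have : h * h^-1 = 1 by rewrite mulfV ?gt_eqF.
have : 0 < h^-1 by rewrite invr_gt0.
rewrite xh xh'; set g := h^-1 => g0 hg g1 h2.
have : h - g <= h * x by have := ler_wpM2l (ltW h0) g1; nra.
have : 0 <= h - g by nra.
move=> hg0 hgx e1.
have : (h - g) ^+ 2 <= (h * x) ^+ 2 by rewrite ler_sqr ?nnegrE// (le_trans hg0).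
rewrite exprMn; nra.
Qed.

(** Independence of the signs factors the exponential moment over coordinates; each factor is
    controlled by [cosh_le]. *)
Lemma rexp_expR_pairing (J : {set 'I_n}) w (sigma : R) :
  (forall i, i \notin J -> w i = 0) -> (forall i, i \in J -> `|w i| <= sigma) ->
  rexp (fun e => expR (pairing w e)) <= expR (2 * sigma ^+ 2 * #|J|%:R).
Proof.
move=> w0 ws; rewrite /rexp /pairing.
under eq_bigr do rewrite expR_sum.
rewrite -(bigA_distr_bigA (fun i (b : bool) => expR ((-1) ^+ b * w i)))/=.
have -> : expR (2 * sigma ^+ 2 * #|J|%:R) =
    (2 ^+ n)^-1 * \prod_(i < n) (2 * expR (if i \in J then 2 * sigma ^+ 2 else 0)).
  rewrite big_split/= prodr_const card_ord mulKf ?gt_eqF ?exprn_gt0//.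
  rewrite -expR_sum; congr expR; rewrite -big_mkcond sumr_const.
  by rewrite mulr_natr.
rewrite ler_wpM2l ?invr_ge0 ?exprn_ge0//; apply: ler_prod => i _.
rewrite big_bool/= expr0 expr1 mul1r mulN1r addr_ge0 ?expR_ge0//= addrC.
apply: le_trans (cosh_le _) _; rewrite ler_pM2l// ler_expR.
case: ifPn => [/ws iJ|/w0 ->]; last by rewrite expr0n mulr0.
rewrite ler_pM2l// -real_normK ?num_real// ler_sqr ?nnegrE//.
exact: le_trans iJ.
Qed.

(* The exponential of the chosen term is at most the sum of the exponentials
   over the whole class. *)
Lemma rexp_finite_class (K : finType) (S : {set K}) (w : K -> 'I_n -> R)
    (J : {set 'I_n}) (sigma H : R) (phi : {ffun 'I_n -> bool} -> K) :
  (forall e, phi e \in S) -> (0 < #|J|)%N -> 0 < sigma -> 0 < H ->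
  ln #|S|%:R <= H ->
  (forall k i, k \in S -> i \notin J -> w k i = 0) ->
  (forall k i, k \in S -> i \in J -> `|w k i| <= sigma) ->
  rexp (fun e => pairing (w (phi e)) e) <= 3 * sigma * Num.sqrt (H * #|J|%:R).
Proof.
move=> phiS J0 s0 H0 SH w0 ws.
have J0' : 0 < #|J|%:R :> R by rewrite ltr0n.
have S0 : 0 < #|S|%:R :> R.
  rewrite ltr0n; apply/card_gt0P; exists (phi [ffun=> true]); exact: phiS.
set r := Num.sqrt _; have r0 : 0 < r by rewrite sqrtr_gt0 mulr_gt0.
have r2 : r ^+ 2 = H * #|J|%:R by rewrite sqr_sqrtr// mulr_ge0// ltW.
(* With this choice [H / l] and [l * sigma ^+ 2 * #|J|] both equal [sigma * r], so [c / l] is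
   [3 * sigma * r]. *)
pose l := r / (#|J|%:R * sigma).
have l0 : 0 < l by rewrite divr_gt0// mulr_gt0.
pose c := H + 2 * (l * sigma) ^+ 2 * #|J|%:R.
suff : l * rexp (fun e => pairing (w (phi e)) e) <= c.
  rewrite -ler_pdivlMl// => /le_trans; apply; rewrite ler_pdivrMl// /c.
  rewrite -subr_ge0 /l (_ : _ - _ = 3 * r ^+ 2 / #|J|%:R - H - 2 * r ^+ 2 / #|J|%:R).
    by rewrite r2 !mulrA !mulfK ?gt_eqF//; lra.
  by field; rewrite !gt_eqF.
(* The inequality [t <= exp t - 1] at [t = l * pairing - c] takes the place of Jensen's
   inequality. *)
rewrite -subr_le0 -rexpZ -[c]rexp_cst -mulN1r -rexpZ -rexpD.
apply: le_trans (_ : rexp (fun e => \sum_(k in S) expR (- c) *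
   expR (pairing (fun i => l * w k i) e) + -1) <= _).
  apply: le_rexp => e; rewrite mulN1r lerBrDr.
  have -> : l * pairing (w (phi e)) e = pairing (fun i => l * w (phi e) i) e.
    by rewrite /pairing mulr_sumr; apply: eq_bigr => i _; ring.
  set a := pairing _ _; apply: le_trans (_ : expR (- c) * expR a <= _).
    by rewrite -expRD; have := expR_ge1Dx (- c + a); lra.
  by rewrite (bigD1 (phi e))//= lerDl sumr_ge0.
rewrite rexpD rexp_cst rexp_sum subr_le0.
apply: le_trans (_ : \sum_(k in S) expR (- c) * expR (2 * (l * sigma) ^+ 2 * #|J|%:R) <= _).
  apply: ler_sum => k kS; rewrite rexpZ ler_wpM2l ?expR_ge0//.
  apply: rexp_expR_pairing => i iJ; first by rewrite w0// mulr0.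
  by rewrite normrM gtr0_norm// ler_pM2l// ws.
rewrite sumr_const -expRD -[_ *+ _]mulr_natl -(@lnK R #|S|%:R) ?posrE// -expRD.
by rewrite expR_le1 /c; lra.
Qed.

(** The vector [v e] depends on the signs, so a bound uniform over the class is needed. Telescope
    along [pi 0, ..., pi m]: each link ranges over a finite class, and the final error is estimated
    coordinatewise. *)
Lemma rexp_chaining (J : {set 'I_n}) (v : {ffun 'I_n -> bool} -> 'I_n -> R)
    (m : nat) (pi : nat -> {ffun 'I_n -> bool} -> {ffun 'I_n -> bool})
    (H : nat -> R) (B : R) :
  (0 < #|J|)%N ->
  (forall e i, i \notin J -> v e i = 0) ->
  (forall e i, `|v e i| <= 1) ->
  (forall k, 0 < H k) -> {homo H : k l / (k <= l)%N >-> k <= l} ->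
  (forall k, (k <= m)%N -> ln #|[set pi k e | e in [set: {ffun 'I_n -> bool}]]%SET|%:R <= H k) ->
  (forall k e i, (k <= m)%N -> `|v (pi k e) i - v e i| <= 2^-1 ^+ k) ->
  (forall k, (k <= m)%N -> 12 * 2^-1 ^+ k * Num.sqrt (2 * H k * #|J|%:R) <= B) ->
  rexp (fun e => pairing (v e) e) <= 2^-1 ^+ m * #|J|%:R + m.+1%:R * B.
Proof.
move=> J0 v0 v1 H0 Hmono lnH vpi HB.
have J0' : 0 < #|J|%:R :> R by rewrite ltr0n.
pose net k := [set pi k e | e in [set: {ffun 'I_n -> bool}]]%SET.
have pinet k e : pi k e \in net k by apply/imsetP; exists e.
have net0 k : 0 < #|net k|%:R :> R.
  by rewrite ltr0n; apply/card_gt0P; exists (pi k [ffun=> true]).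
have h0 k : 0 < 2^-1 ^+ k :> R by rewrite exprn_gt0.
have chain k : (k <= m)%N ->
    rexp (fun e => pairing (v (pi k e)) e) <= k.+1%:R * B.
  elim: k => [_|k IH km].
    rewrite mul1r; apply: le_trans (_ : 3 * 1 * Num.sqrt (H 0%N * #|J|%:R) <= _).
      apply: (@rexp_finite_class _ (net 0%N) v).
      - exact: pinet.
      - by [].
      - by [].
      - by [].
      - exact: lnH.
      - by move=> k i _; exact: v0.
      - by move=> k i _ _; exact: v1.
    apply: le_trans (HB 0%N (leq0n _)); rewrite expr0 !mulr1; apply: ler_pM => //.
      by lra.
    by rewrite ler_wsqrtr// ler_pM2r//; have := H0 0%N; lra.
  pose w (p : {ffun 'I_n -> bool} * {ffun 'I_n -> bool}) i := v p.1 i - v p.2 i.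
  pose phi e := (pi k.+1 e, pi k e).
  pose S := [set phi e | e in [set: {ffun 'I_n -> bool}]]%SET.
  have -> : rexp (fun e => pairing (v (pi k.+1 e)) e) =
      rexp (fun e => pairing (v (pi k e)) e) + rexp (fun e => pairing (w (phi e)) e).
    rewrite -rexpD; congr (_ * _); apply: eq_bigr => e _.
    by rewrite /pairing -big_split; apply: eq_bigr => i _; rewrite /w /=; ring.
  rewrite -[in leRHS]natr1 mulrDl mul1r lerD ?IH ?(ltnW km)//.
  apply: le_trans (HB _ km).
  (* Consecutive approximants differ by at most three, hence four, times [2^-1 ^+ k.+1]. A link is a
     pair from two nets, so its log-cardinality is at most [2 * H k.+1]. *)
  apply: le_trans (_ : 3 * (4 * 2^-1 ^+ k.+1) * Num.sqrt (2 * H k.+1 * #|J|%:R) <= _).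
    apply: (@rexp_finite_class _ S w).
    - by move=> e; apply/imsetP; exists e.
    - by [].
    - by rewrite mulr_gt0.
    - by rewrite mulr_gt0.
    - have SS : (#|S| <= #|net k.+1| * #|net k|)%N.
        rewrite -cardsX; apply/subset_leq_card/fintype.subsetP => _ /imsetP[e _ ->].
        by rewrite inE !pinet.
      apply: le_trans (_ : ln (#|net k.+1| * #|net k|)%:R <= _).
        rewrite ler_ln ?posrE ?natrM ?mulr_gt0 ?ler_nat -?natrM ?ler_nat//.
        by rewrite ltr0n; apply/card_gt0P; exists (phi [ffun=> true]);
          apply/imsetP; exists [ffun=> true].
      rewrite natrM lnM ?posrE//.
      by have := lnH _ km; have := lnH _ (ltnW km); have := Hmono _ _ (leqnSn k); rewrite /net; lra.
    - by move=> _ i /imsetP[e _ ->] iJ; rewrite /w !v0// subrr.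
    - move=> _ i /imsetP[e _ ->] _; rewrite /w /phi /=.
      have -> : v (pi k.+1 e) i - v (pi k e) i =
        (v (pi k.+1 e) i - v e i) - (v (pi k e) i - v e i) by ring.
      apply: le_trans (ler_normB _ _) _.
      have := vpi _ e i km; have := vpi _ e i (ltnW km); have := h0 k.
      by rewrite exprS; lra.
  by rewrite mulrA (_ : 3 * 4 = 12 :> R)//; ring.
rewrite (_ : rexp _ = rexp (fun e => pairing (fun i => v e i - v (pi m e) i) e) +
    rexp (fun e => pairing (v (pi m e)) e)); last first.
  rewrite -rexpD; congr (_ * _); apply: eq_bigr => e _.
  by rewrite /pairing -big_split; apply: eq_bigr => i _ /=; ring.
rewrite lerD ?chain// -[leRHS]rexp_cst; apply: le_rexp => e.
rewrite /pairing (bigID (mem J))/= [X in _ + X]big1 ?addr0; last first.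
  by move=> i iJ; rewrite !v0// subrr mulr0.
rewrite mulr_natr -sumr_const; apply: ler_sum => i _.
apply: le_trans (ler_norm _) _; rewrite normrM normrX normrN1 expr1n mul1r distrC.
exact: vpi.
Qed.

End Chaining.

(** * From shattering to Rademacher averages *)

Section Entropy.
Context {R : realType} {X : normedModType R}.
Implicit Types (A q delta : R).

Definition l1_decay A q := forall m (x : 'I_m -> X) delta, 0 < delta ->
  (forall i, `|x i| <= 1) -> lower_l1 delta x -> m%:R <= A * delta `^ (- q).

(** If [N ^ k <= m < N ^ k.+1], the system contains a copy of [blocks k], so [delta <= eps ^+ k]. As
    [eps ^ (- q) = N], this gives [N ^ k <= delta ^ (- q)], and rounding [m] costs one factor
    [N]. *)
Lemma l1_decay_of_small N eps q : (1 < N)%N -> 0 < eps -> eps `^ q = N%:R^-1 ->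
  0 <= q ->
  (forall x : 'I_N -> X, (forall i, `|x i| <= 1) -> ~ lower_l1 eps x) ->
  l1_decay N%:R q.
Proof.
move=> N1 eps0 epsq q0 Nsmall m x delta d0 x1 lx.
have [->|m0] := posnP m; first by rewrite mulr_ge0// powR_ge0.
have /andP[Nm mN] := trunc_log_bounds N1 m0; set k := trunc_log N m in Nm mN.
have lt_m (b : blocks N k) : (enum_rank b < m)%N.
  by apply: leq_trans (ltn_ord _) _; rewrite card_blocks.
have hinj : injective (fun b => Ordinal (lt_m b)).
  by move=> b c /(congr1 val)/= /ord_inj/enum_rank_inj.
have := lower_l1_blocks eps0 Nsmall _ (lower_l1_comp hinj lx).
move=> /(_ (fun b => x1 _)) dk.
have : m%:R <= N%:R * N%:R ^+ k :> R by rewrite -exprS -natrX ler_nat ltnW.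
move=> /le_trans; apply; rewrite ler_wpM2l//.
have -> : N%:R ^+ k = (eps ^+ k) `^ (- q).
  rewrite powRN -(powR_mulrn k (ltW eps0)) powRAC epsq powR_mulrn ?invr_ge0//.
  by rewrite exprVn invrK.
rewrite !powRN lef_pV2 ?posrE ?powR_gt0 ?exprn_gt0//.
by apply: ge0_ler_powR; rewrite ?nnegrE ?exprn_ge0 ?(ltW eps0) ?(ltW d0).
Qed.

Lemma l1_decay_card A q (I : finType) (x : I -> X) delta : l1_decay A q ->
  0 < delta -> (forall i, `|x i| <= 1) -> lower_l1 delta x ->
  #|I|%:R <= A * delta `^ (- q).
Proof.
move=> Aq d0 x1 lx; apply: (Aq _ (x \o enum_val)) => // [i|]; first exact: x1.
by apply: lower_l1_comp lx; exact: enum_val_inj.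
Qed.

(** A maximal set of pairwise far points is a net, and [pi] projects onto it. *)
Lemma finite_net (T : finType) (far : rel T) (c : nat) :
  symmetric far -> irreflexive far ->
  (forall S : {set T}, {in S &, forall t u, t != u -> far t u} -> (#|S| < c)%N) ->
  exists2 pi : T -> T, forall t, ~~ far (pi t) t & (#|[set pi t | t in [set: T]]%SET| < c)%N.
Proof.
move=> fsym firr fc.
pose P (S : {set T}) := [forall t in S, forall u in S, (t != u) ==> far t u].
have [|S /maxsetP[PS Smax]] := @ex_maxset _ P.
  by exists finset.set0; apply/forallP => t; rewrite inE.
have Sfar : {in S &, forall t u, t != u -> far t u}.
  by move=> t u tS uS; have /forall_inP/(_ t tS)/forall_inP/(_ u uS)/implyP := PS.
have /choice[pi Hpi] t : exists s, s \in S /\ ~~ far s t.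
  have [tS|tS] := boolP (t \in S); first by exists t; rewrite firr.
  apply: contrapT => H; have far_t s : s \in S -> far s t.
    by move=> sS; apply: contrapT => /negP nf; apply: H; exists s.
  have : (t |: S)%SET = S; last by move/finset.setP/(_ t); rewrite !inE eqxx (negPf tS).
  apply: Smax; last exact: finset.subsetUr.
  apply/forall_inP => u; rewrite !inE => /predU1P[->|uS].
    apply/forall_inP => w; rewrite !inE => /predU1P[->|wS]; first by rewrite eqxx.
    by apply/implyP => _; rewrite fsym far_t.
  apply/forall_inP => w; rewrite !inE => /predU1P[->|wS].
    by apply/implyP => _; exact: far_t.
  by apply/implyP; exact: Sfar.
exists pi; first by move=> t; exact: (Hpi t).2.
apply: leq_ltn_trans (fc S Sfar); apply/subset_leq_card/fintype.subsetP.
by move=> _ /imsetP[t _ ->]; exact: (Hpi t).1.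
Qed.

(** Values on the points are rounded to a grid of mesh [1 / z] with [z = 3 * 2 ^+ k]. Functionals
    more than [2^-1 ^+ k] apart then have levels two apart, while shattered levels give a lower l1
    estimate with constant [1 / (2 z)]. The decay hypothesis thus bounds shattered domains by
    [d]. *)
Lemma dual_ball_net A q n (J : {set 'I_n}) (x : 'I_n -> X) (T : finType)
    (f : T -> X -> R) (k d kappa : nat) (b := (6 * 2 ^ k).+1) :
  l1_decay A q -> (0 < #|J|)%N -> (forall i, `|x i| <= 1) ->
  (forall i, i \notin J -> x i = 0) ->
  (forall t, contractive_functional (f t)) ->
  A * (6 * 2 ^+ k) `^ q < d.+1%:R -> ((#|J| * b).+1 ^ d < 2 ^ kappa)%N ->
  exists2 pi : T -> T, forall t i, `|f (pi t) (x i) - f t (x i)| <= 2^-1 ^+ k &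
    (#|[set pi t | t in [set: T]]%SET| < (2 * (#|J| * (b * b))) ^ kappa)%N.
Proof.
move=> Aq J0 x1 xJ cf Ad dk.
pose I := {i : 'I_n | i \in J}.
have cI : #|{: I}| = #|J| by rewrite card_sig; apply: eq_card => i; rewrite inE.
pose z : R := 3 * 2 ^+ k.
have z0 : 0 < z by rewrite mulr_gt0// exprn_gt0.
pose lev t (i : 'I_n) := Num.truncn (z * (f t (x i) + 1)).
have fle t i : - 1 <= f t (x i) <= 1.
  by rewrite -ler_norml; apply: le_trans (x1 i); exact: (cf t).2.
have levP t i : (lev t i)%:R <= z * (f t (x i) + 1) < (lev t i).+1%:R.
  by apply: truncn_itv; rewrite mulr_ge0 ?(ltW z0)//; have /andP[] := fle t i; lra.
have levb t i : (lev t i < b)%N.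
  rewrite -(ltr_nat R) /b -natr1 natrM natrX; have /andP[h _] := levP t i.
  have /andP[_ h'] := fle t i; apply: le_lt_trans h _.
  by have := ler_wpM2l (ltW z0) h'; rewrite /z; lra.
pose v t (i : I) : 'I_b := Ordinal (levb t (val i)).
pose far t u := [exists i, 2^-1 ^+ k < `|f t (x i) - f u (x i)|].
have [|||pi farpi cpi] := @finite_net T far ((2 * (#|J| * (b * b))) ^ kappa).
- by move=> t u; apply/existsP/existsP => -[i H]; exists i; rewrite distrC.
- move=> t; apply/negbTE/existsPn => i; rewrite subrr normr0 -leNgt.
  by rewrite exprn_ge0.
- move=> S Sfar; rewrite -cI; apply: (@separated_card_lt _ _ b v d).
  + by rewrite cI muln_gt0 J0.
  + move=> t u tS uS tu; have /existsP[i farI] := Sfar t u tS uS tu.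
    have iJ : i \in J.
      apply: contraT => /xJ xi0; move: farI; rewrite xi0.
      by rewrite !(scalar0 (cf _).1) subrr normr0 ltNge exprn_ge0.
    exists (exist _ i iJ); rewrite /v /=.
    have /andP[t1 t2] := levP t i; have /andP[u1 u2] := levP u i.
    have zk : z * 2^-1 ^+ k = 3.
      by rewrite /z -mulrA -exprMn divff ?expr1n ?mulr1.
    have fz : 3 < z * `|f t (x i) - f u (x i)| by rewrite -zk ltr_pM2l.
    have [h|h] := leP (f u (x i)) (f t (x i)).
      right; rewrite -(ltr_nat R) -natr1; move: fz; rewrite ger0_norm ?subr_ge0//.
      by move: t2; rewrite -natr1; lra.
    left; rewrite -(ltr_nat R) -natr1; move: fz; rewrite ltr0_norm ?subr_lt0//.
    by move: u2; rewrite -natr1; lra.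
  + move=> g /strongly_shatteredP Sg; rewrite leqNgt; apply/negP => dg.
    pose K := {i : I | i \in domain g}.
    have cK : #|{: K}| = #|domain g| by rewrite card_sig; apply: eq_card => i; rewrite inE.
    have : #|{: K}|%:R <= A * ((2 * z)^-1) `^ (- q).
      apply: (@l1_decay_card A q K (fun i => x (val (val i)))) => //.
        by rewrite invr_gt0 mulr_gt0.
      (* A level above [s] means [z * (f + 1) >= s + 1], one below [s] means [z * (f + 1) < s]; the
         threshold [s + 1/2] leaves a margin of 1/2 on both sides. *)
      apply: (@lower_l1_of_sign_patterns _ _ _ _
        (fun i => (odflt 0%N (omap val (g (val i))))%:R / z + (2 * z)^-1 - 1)) => B.
      have [t tS Ht] := Sg (val @: B); exists (f t) => //.
      have zz : z * (2 * z)^-1 = 2^-1 by field; rewrite gt_eqF.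
      have gS (i : K) : exists s, g (val i) = Some s.
        have : g (val i) != None by rewrite -mem_domain; exact: (valP i).
        by case: (g _) => // s _; exists s.
      split=> i iB; have [s gi] := gS i; rewrite gi /=; have := Ht _ _ gi.
      * rewrite imset_f// => sv; rewrite -(ler_pM2l z0) !mulrDr zz mulrC divfK ?gt_eqF//.
        have /andP[h _] := levP t (val (val i)).
        have : s.+1%:R <= (lev t (val (val i)))%:R :> R by rewrite ler_nat.
        by rewrite -natr1; lra.
      * rewrite (mem_imset _ _ val_inj) (negPf iB).
        move=> sv; rewrite -(ler_pM2l z0) !mulrDr !mulrN zz.
        have zs : z * (s%:R / z) = s%:R by rewrite mulrC divfK ?gt_eqF.
        rewrite zs; have /andP[_ h] := levP t (val (val i)).
        have : (lev t (val (val i))).+1%:R <= s%:R :> R by rewrite ler_nat.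
        by lra.
    rewrite powRN -[X in X `^ q](powR_inv1 (_ : 0 <= 2 * z)) ?mulr_ge0 ?(ltW z0)//.
    rewrite powRAC powR_inv1 ?powR_ge0// invrK cK.
    rewrite (_ : 2 * z = 6 * 2 ^+ k); last by rewrite /z; ring.
    by move=> /le_lt_trans /(_ Ad); rewrite ltr_nat ltnNge dg.
  + by rewrite cI.
exists pi => // t i; rewrite leNgt; apply/negP => h.
by have /existsPn/(_ i) := farpi t; rewrite h.
Qed.

End Entropy.

(** * Chaining bound for Rademacher averages under l1 decay *)

Section RademacherBound.
Context {R : realType} {X : completeNormedModType R}.
Implicit Types (A q : R).

Lemma norm_family_sum n (x : 'I_n -> X) (f : {ffun 'I_n -> bool} -> X -> R) :
  (forall e, contractive_functional (f e)) ->
  (forall e, f e (\sum_i (-1) ^+ e i *: x i) = `|\sum_i (-1) ^+ e i *: x i|) ->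
  rademacher_mean x = rexp (fun e => pairing (fun i => f e (x i)) e).
Proof.
move=> cf fx; congr (_ * _); apply: eq_bigr => e _.
by rewrite -fx (scalar_sum _ _ (cf e).1).
Qed.

Lemma expR_le_pow2 (t : R) k : t <= k%:R / 2 -> expR t <= 2 ^+ k.
Proof.
move=> tk; apply: le_trans (_ : expR (k%:R / 2) <= _); first by rewrite ler_expR.
by rewrite mulrC expRM_natr; apply: lerXn2r; rewrite ?nnegrE ?expR_ge0 ?expR_half_le2.
Qed.

Lemma half_le_ln_pow2 (t : R) k : 2 ^+ k <= expR t -> k%:R / 2 <= t.
Proof.
by move=> h; rewrite -ler_expR; apply: le_trans h; exact: expR_le_pow2.
Qed.

(** For [y = 2 ^+ k] and [u ^ q = m], the left side is the size of the [k]-th chaining term up to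
    constants and logarithms. As [q >= 2], it grows with [y] and is largest at [y = u]. *)
Lemma sqrt_powR_le (y u q : R) : 0 < y -> y <= u -> 2 <= q ->
  y^-1 * Num.sqrt (y `^ q * u `^ q) <= u `^ (q - 1).
Proof.
move=> y0 yu q2; have u0 : 0 < u by exact: lt_le_trans yu.
rewrite ler_pdivrMl//.
have -> : y * u `^ (q - 1) = Num.sqrt ((y * u `^ (q - 1)) ^+ 2).
  by rewrite sqrtr_sqr ger0_norm// mulr_ge0 ?powR_ge0 ?ltW.
rewrite ler_wsqrtr// exprMn.
have split_q (z : R) : 0 < z -> z `^ q = z `^ (q - 2) * z ^+ 2.
  by move=> z0; rewrite -powR_mulrn ?(ltW z0)// -powRD ?subrK// (gt_eqF z0) implybT.
have -> : (u `^ (q - 1)) ^+ 2 = u `^ (q - 2) * u `^ q.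
  rewrite expr2 -!powRD ?(gt_eqF u0) ?implybT//; congr (_ `^ _); ring.
have h : y `^ (q - 2) <= u `^ (q - 2).
  by apply: ge0_ler_powR; rewrite ?nnegrE ?subr_ge0 ?(ltW y0) ?(ltW u0).
rewrite (split_q y)// -subr_ge0.
rewrite (_ : _ - _ = (u `^ (q - 2) - y `^ (q - 2)) * (y ^+ 2 * u `^ q)); last ring.
by rewrite mulr_ge0 ?subr_ge0// mulr_ge0 ?powR_ge0 ?sqr_ge0.
Qed.

(** Chain the norming functionals through the nets of [dual_ball_net]. One factor [lam] is the
    square root of the logarithms in the entropy, the other counts the scales. The argument [98 m^3]
    dominates [2 m b^2] because [b <= 7 m]. *)
Lemma rademacher_mean_log_bound A q : 1 <= A -> 2 <= q -> l1_decay (X := X) A q ->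
  forall n (J : {set 'I_n}) (x : 'I_n -> X), (0 < #|J|)%N ->
  (forall i, `|x i| <= 1) -> (forall i, i \notin J -> x i = 0) ->
  rademacher_mean x <= (2 + 36 * Num.sqrt (8 * A * 6 `^ q)) *
    ln (98 * #|J|%:R ^+ 3) ^+ 2 * #|J|%:R `^ (1 - q^-1).
Proof.
move=> A1 q2 Aq n J x J0 x1 xJ; set m := #|J|; set lam := ln _.
have q0 : 0 < q by lra.
have A0 : 0 < A by lra.
have m1 : 1 <= m%:R :> R by rewrite ler1n.
have m0 : 0 < m%:R :> R by rewrite ltr0n.
have /choice[f Hf] (e : {ffun 'I_n -> bool}) : exists f : X -> R, contractive_functional f /\
    f (\sum_i (-1) ^+ e i *: x i) = `|\sum_i (-1) ^+ e i *: x i|.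
  by have [f cf fx] := norming_functional (\sum_i (-1) ^+ e i *: x i); exists f.
have cf e := (Hf e).1; rewrite (norm_family_sum cf (fun e => (Hf e).2)).
have m3 : 0 < 98 * m%:R ^+ 3 :> R by rewrite mulr_gt0// exprn_gt0.
have elam : expR lam = 98 * m%:R ^+ 3 by rewrite lnK ?posrE.
have m23 : m%:R ^+ 2 <= m%:R ^+ 3 :> R by rewrite ler_weXn2l ?ler1n.
have m13 : m%:R <= m%:R ^+ 3 :> R by rewrite -[leLHS]expr1 ler_weXn2l.
have lam1 : 1 <= lam.
  rewrite -ler_expR elam; have := @expR_le_pow2 1 2 ltac:(lra); lra.
pose u : R := m%:R `^ q^-1.
have uq : u `^ q = m%:R by rewrite -powRrM mulVf ?gt_eqF// powRr1// ltW.
have uq1 : m%:R `^ (1 - q^-1) = u `^ (q - 1).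
  by rewrite -powRrM; congr (_ `^ _); field; rewrite gt_eqF.
have u1 : 1 <= u by rewrite -(powRr0 m%:R) ler_powR// invr_ge0 ltW.
have u0 : 0 < u by lra.
have um : u <= m%:R.
  apply: ler1_powR => //; rewrite invf_le1//; lra.
(* The finest scale [2 ^- K] is chosen so that the discretisation error
   [2 ^- K * m] matches [m `^ (1 - 1 / q)]. *)
have [K Ku uK] : exists2 K, 2 ^+ K <= u & u <= 2 ^+ K.+1.
  have /andP[tu uS] : (Num.truncn u)%:R <= u < (Num.truncn u).+1%:R.
    by apply: truncn_itv; exact: ltW.
  have t0 : (0 < Num.truncn u)%N by rewrite truncn_gt0.
  have /andP[K1 K2] := trunc_log_bounds (isT : 1 < 2)%N t0.
  exists (trunc_log 2 (Num.truncn u)).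
    by apply: le_trans tu; rewrite -natrX ler_nat.
  by apply/ltW/(lt_le_trans uS); rewrite -natrX ler_nat.
have ku k : (k <= K)%N -> 2 ^+ k <= u.
  by move=> kK; apply: le_trans Ku; rewrite ler_weXn2l ?ler1n.
have pow0 k : 0 < 2 ^+ k :> R by rewrite exprn_gt0.
have KL : K.+1%:R <= 3 * lam.
  have : K%:R / 2 <= lam by apply: half_le_ln_pow2; rewrite elam; lra.
  by rewrite -(natr1 K); lra.
have [L L1 L2] : exists2 L : nat, L%:R <= 3 * lam & 98 * m%:R ^+ 3 <= 2 ^+ L :> R.
  exists (Num.truncn (2 * lam)).+1.
    by have /andP[h _] := @truncn_itv R (2 * lam) ltac:(lra); rewrite -[in leLHS]natr1; lra.
  by rewrite -elam; apply: expR_le_pow2; have := truncnS_gt (2 * lam); lra.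
pose D k : R := A * (6 * 2 ^+ k) `^ q.
have D1 k : 1 <= D k.
  have k1 : 1 <= 6 * 2 ^+ k :> R.
    have : 1 <= 2 ^+ k :> R by rewrite exprn_ege1 ?ler1n.
    lra.
  have := ler_powR k1 (ltW q0); rewrite powRr0 /D; nra.
(* The net at scale [k] has at most [(2 m b^2) ^ (d L + 1)] elements; the exponent is at most
   [4 * D k * lam] and the logarithm of the base at most [lam]. *)
pose H k := 4 * D k * lam ^+ 2.
pose B := 12 * Num.sqrt (8 * A * 6 `^ q) * lam * u `^ (q - 1).
have nets k : exists pi : {ffun 'I_n -> bool} -> {ffun 'I_n -> bool}, (k <= K)%N ->
    (forall e i, `|f (pi e) (x i) - f e (x i)| <= 2^-1 ^+ k) /\
    ln #|[set pi e | e in [set: {ffun 'I_n -> bool}]]%SET|%:R <= H k.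
  have [kK|] := leqP k K; last by exists id.
  have [d [d0 dD Dd]] : exists d : nat, [/\ (0 < d)%N, d%:R <= D k & D k < d.+1%:R].
    exists (Num.truncn (D k)); rewrite truncn_gt0 D1.
    by have /andP[] := @truncn_itv R (D k) (le_trans ler01 (D1 k)).
  pose b := (6 * 2 ^ k).+1.
  have bm : b%:R <= 7 * m%:R :> R.
    have := ku k kK; have := exprn_ege1 k (ler1n R 2); rewrite /b -(natr1 (6 * 2 ^ k)) natrM natrX.
    lra.
  have b0 : 0 < b%:R :> R by rewrite ltr0n.
  have kap : ((m * b).+1 ^ d < 2 ^ (d * L).+1)%N.
    apply: (@leq_ltn_trans ((2 ^ L) ^ d)%N); last by rewrite -expnM mulnC ltn_exp2l.
    rewrite leq_exp2r// -(ler_nat R) natrX; apply: le_trans L2.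
    by rewrite -[in leLHS]natr1 natrM; nra.
  have [|pi pi1 pi2] := dual_ball_net (f := f) Aq J0 x1 xJ cf _ kap.
    exact: Dd.
  exists pi => _; split=> //; rewrite -/b -/m in pi2.
  set N := #|_| in pi2 *; have N0 : 0 < N%:R :> R.
    by rewrite ltr0n; apply/card_gt0P; exists (pi [ffun=> true]);
      apply/imsetP; exists [ffun=> true].
  have M0 : 0 < (2 * (m * (b * b)))%:R :> R by rewrite ltr0n !muln_gt0 J0.
  have Mlam : ln (2 * (m * (b * b)))%:R <= lam.
    rewrite ler_ln ?posrE// !natrM.
    have bb : b%:R * b%:R <= (7 * m%:R) * (7 * m%:R) :> R.
      by apply: ler_pM => //; exact: ltW.
    by have := ler_wpM2l (ltW m0) bb; lra.
  apply: le_trans (_ : ln ((2 * (m * (b * b))) ^ (d * L).+1)%:R <= _).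
    by rewrite ler_ln ?posrE ?natrX ?exprn_gt0// -natrX ler_nat ltnW.
  rewrite natrX lnXn// -[_ *+ (d * L).+1]mulr_natl.
  have kapD : (d * L).+1%:R <= 4 * D k * lam.
    rewrite -[in leLHS]natr1 natrM; have := D1 k.
    have : d%:R * L%:R <= D k * (3 * lam) by rewrite ler_pM.
    nra.
  apply: le_trans (_ : (d * L).+1%:R * lam <= _); first by rewrite ler_wpM2l.
  by rewrite /H expr2 mulrA ler_wpM2r//; lra.
have /choice[pi Hpi] := nets.
rewrite uq1; apply: le_trans (_ : 2^-1 ^+ K * m%:R + K.+1%:R * B <= _).
  apply: (@rexp_chaining R n J (fun e i => f e (x i)) K pi H B) => //.
  - by move=> e i /xJ ->; exact: scalar0 (cf e).1.
  - by move=> e i; apply: le_trans (x1 i); exact: (cf e).2.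
  - by move=> k; rewrite /H !mulr_gt0// ?exprn_gt0//; have := D1 k; lra.
  - move=> k l kl; rewrite /H ler_wpM2r ?sqr_ge0// ler_pM2l// ler_pM2l//.
    have nn j : 6 * 2 ^+ j \is @Num.nneg R by rewrite nnegrE mulr_ge0// ltW.
    by apply: ge0_ler_powR => //; [exact: ltW | rewrite ler_pM2l// ler_weXn2l ?ler1n].
  - by move=> k /Hpi[].
  - by move=> k e i /Hpi[].
  - move=> k kK; have y0 := pow0 k.
    have -> : 2 * H k * m%:R = (8 * A * 6 `^ q * lam ^+ 2) * ((2 ^+ k) `^ q * u `^ q).
      rewrite /H /D uq powRM ?(ltW y0)//.
      by ring.
    have S0 : 0 <= 8 * A * 6 `^ q by rewrite !mulr_ge0 ?powR_ge0// ltW.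
    rewrite sqrtrM; last by rewrite mulr_ge0 ?sqr_ge0.
    rewrite sqrtrM// sqrtr_sqr ger0_norm; last lra.
    have := sqrt_powR_le y0 (ku k kK) q2; rewrite exprVn /B.
    set V := _ * Num.sqrt (_ * _); move=> VU.
    rewrite [leLHS](_ : _ = 12 * Num.sqrt (8 * A * 6 `^ q) * lam * V); last by rewrite /V; ring.
    by rewrite ler_wpM2l// !mulr_ge0 ?sqrtr_ge0//; lra.
have U0 : 0 < u `^ (q - 1) by rewrite powR_gt0.
have B0 : 0 <= B by rewrite !mulr_ge0 ?sqrtr_ge0 ?(ltW U0)//; lra.
have rem : 2^-1 ^+ K * m%:R <= 2 * u `^ (q - 1).
  rewrite -uq -(mulr_powRB1 (ltW u0) q0) exprVn ler_pdivrMl// mulrA ler_wpM2r ?(ltW U0)//.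
  by rewrite mulrC -exprS.
have lam2 : 1 <= lam ^+ 2 by rewrite exprn_ege1.
have : K.+1%:R * B <= 3 * lam * B by rewrite ler_wpM2r.
rewrite /B; set S := Num.sqrt _; set U := u `^ _ in U0 rem *.
have : U <= lam ^+ 2 * U by rewrite ler_peMl// ltW.
lra.
Qed.

End RademacherBound.

(** * From Rademacher averages to type *)

Section TypeFromRademacherBound.
Context {R : realType} {X : completeNormedModType R}.
Implicit Types (A q r s C : R).

(** The signs stay indexed by all of ['I_n] and only the support [J] is counted, so that blocks of
    one family need no reindexing. *)
Definition set_rademacher_bound C s := forall n (J : {set 'I_n}) (x : 'I_n -> X),
  (forall i, `|x i| <= 1) -> (forall i, i \notin J -> x i = 0) ->
  rademacher_mean x <= C * #|J|%:R `^ s^-1.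

Lemma rademacher_mean0 n (x : 'I_n -> X) : (forall i, x i = 0) -> rademacher_mean x = 0.
Proof.
move=> x0; rewrite /rademacher_mean big1 ?mulr0// => e _.
by rewrite big1 ?normr0// => i _; rewrite x0 scaler0.
Qed.

Lemma rademacher_meanZ n (c : R) (x : 'I_n -> X) : 0 <= c ->
  rademacher_mean (fun i => c *: x i) = c * rademacher_mean x.
Proof.
move=> c0; rewrite /rademacher_mean [RHS]mulrCA; congr (_ * _).
rewrite mulr_sumr; apply: eq_bigr => e _.
rewrite -[X in X * _](ger0_norm c0) -normrZ scaler_sumr; congr (`|_|).
by apply: eq_bigr => i _; rewrite !scalerA mulrC.
Qed.

Lemma rademacher_mean_sum n K (y : 'I_K -> 'I_n -> X) :
  rademacher_mean (fun i => \sum_(k < K) y k i) <= \sum_(k < K) rademacher_mean (y k).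
Proof.
rewrite /rademacher_mean -mulr_sumr ler_wpM2l ?invr_ge0 ?exprn_ge0//.
rewrite exchange_big/=; apply: ler_sum => e _.
under eq_bigr do rewrite scaler_sumr.
by rewrite exchange_big/=; exact: ler_norm_sum.
Qed.

Lemma ln_le_powR (y s : R) : 0 < s -> 1 <= y -> ln y <= y `^ s / s.
Proof.
move=> s0 y1; rewrite ler_pdivlMr// mulrC -ln_powR ltW// ln_sublinear// powR_gt0//.
exact: lt_le_trans y1.
Qed.

(** The gap between [1 / r] and [1 - 1 / q] is [6 t]. Bounding the logarithm of [98 m^3] by its
    [t]-th power over [t] and squaring uses up exactly [m ^ (6 t)]. *)
Lemma set_rademacher_bound_of_decay A q r : 1 <= A -> 2 <= q ->
  l1_decay (X := X) A q -> 1 - q^-1 < r^-1 ->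
  exists2 C, 0 <= C & set_rademacher_bound C r.
Proof.
move=> A1 q2 Aq qr; pose t := (r^-1 - (1 - q^-1)) / 6.
have t0 : 0 < t by rewrite /t; lra.
have D0 : 0 <= 2 + 36 * Num.sqrt (8 * A * 6 `^ q) by rewrite addr_ge0// mulr_ge0.
set D := 2 + _ in D0.
exists (D * (98 `^ t / t) ^+ 2); first by rewrite mulr_ge0// sqr_ge0.
move=> n J x x1 xJ; have [J0|J0] := posnP #|J|.
  rewrite rademacher_mean0; first by rewrite mulr_ge0 ?powR_ge0// mulr_ge0// sqr_ge0.
  by move=> i; apply: xJ; rewrite (cards0_eq J0) inE.
apply: le_trans (rademacher_mean_log_bound A1 q2 Aq J0 x1 xJ) _; rewrite -/D.
have m1 : 1 <= #|J|%:R :> R by rewrite ler1n.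
have m0 : 0 < #|J|%:R :> R by rewrite ltr0n.
have y1 : 1 <= 98 * #|J|%:R ^+ 3 :> R by have := exprn_ege1 3 m1; lra.
set m : R := #|J|%:R in m1 m0 y1 *.
rewrite -[leLHS]mulrA -[leRHS]mulrA ler_wpM2l//.
have -> : m `^ r^-1 = (m `^ (3 * t)) ^+ 2 * m `^ (1 - q^-1).
  rewrite -powR_mulrn ?powR_ge0// -powRrM -powRD; last by rewrite (gt_eqF m0) implybT.
  by congr (_ `^ _); rewrite /t; lra.
rewrite [leRHS]mulrA ler_wpM2r ?powR_ge0// -exprMn.
apply: lerXn2r; rewrite ?nnegrE ?ln_ge0 ?mulr_ge0 ?invr_ge0 ?powR_ge0 ?(ltW t0)//.
apply: le_trans (ln_le_powR t0 y1) _.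
by rewrite powRM ?exprn_ge0 ?(ltW m0)// -powR_mulrn ?(ltW m0)// -powRrM mulrAC.
Qed.

Lemma geometric_sum_le (rho : R) K : 0 <= rho -> rho < 1 ->
  \sum_(k < K) rho ^+ k <= (1 - rho)^-1.
Proof.
move=> r0 r1; have r1' : 0 < 1 - rho by lra.
rewrite -[leRHS]mulr1 ler_pdivlMl//.
have := subrX1 rho K; have := exprn_ge0 K r0; lra.
Qed.

Lemma dyadic_scale (t : R) : 0 < t -> t <= 1 ->
  exists k : nat, 2 ^+ k * t <= 1 /\ 1 <= 2 ^+ k.+1 * t.
Proof.
move=> t0 t1; have it1 : 1 <= t^-1 by rewrite invf_ge1.
have /andP[tu uS] := @truncn_itv R t^-1 (le_trans ler01 it1).
have u0 : (0 < Num.truncn t^-1)%N by rewrite truncn_gt0.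
have /andP[K1 K2] := trunc_log_bounds (isT : 1 < 2)%N u0.
exists (trunc_log 2 (Num.truncn t^-1)).
split; [rewrite -ler_pdivlMr// div1r | rewrite -ler_pdivrMr// div1r].
  by apply: le_trans tu; rewrite -natrX ler_nat.
by apply/ltW/(lt_le_trans uS); rewrite -natrX ler_nat.
Qed.

(** Normalise the sum of [|y i| ^ r] to at most 1. At most [2 ^ ((k + 1) r)] vectors have norm about
    [2 ^ (- k)], so their block contributes at most [C 2 ^ (r / s) rho ^ k], and [rho < 1] because
    [r < s]. *)
Lemma has_type_of_set_bound C s r : 0 <= C -> set_rademacher_bound C s ->
  1 <= r -> r < s -> has_type X r.
Proof.
move=> C0 HC r1 rs; split=> //.
have r0 : 0 < r by lra.
have s0 : 0 < s by lra.
have is0 : 0 < s^-1 by rewrite invr_gt0.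
pose rho : R := 2 `^ (r / s - 1).
have rho0 : 0 <= rho by exact: powR_ge0.
have rho1 : rho < 1.
  rewrite -(powRr0 2) /rho /powR gt_eqF// ltr_expR mul0r pmulr_llt0 ?ln_gt0 ?ltr1n//.
  by rewrite subr_lt0 ltr_pdivrMr// mul1r.
pose C' := C * 2 `^ (r / s) * (1 - rho)^-1.
have C'0 : 0 <= C' by rewrite !mulr_ge0 ?powR_ge0// invr_ge0; lra.
suff main n (y : 'I_n -> X) : \sum_(i < n) `|y i| `^ r <= 1 -> rademacher_mean y <= C'.
  exists C' => n x; set S := \sum_(i < n) _.
  have S0 : 0 <= S by apply: sumr_ge0 => i _; exact: powR_ge0.
  move: S0; rewrite le_eqVlt => /predU1P[S0|S0].
    have x0 i : x i = 0.
      have /eqP := esym S0; rewrite psumr_eq0 => [|j _]; last exact: powR_ge0.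
      by move=> /allP/(_ i (mem_index_enum _))/eqP/powR_eq0_eq0/normr0_eq0.
    by rewrite rademacher_mean0//; apply: mulr_ge0 => //; exact: powR_ge0.
  set N := S `^ r^-1; have N0 : 0 < N by exact: powR_gt0.
  have -> : rademacher_mean x = N * rademacher_mean (fun i => N^-1 *: x i).
    rewrite -rademacher_meanZ ?(ltW N0)//; congr rademacher_mean; apply/funext => i.
    by rewrite scalerA mulfV ?gt_eqF// scale1r.
  rewrite mulrC ler_wpM2r ?(ltW N0)//; apply: main.
  rewrite (eq_bigr (fun i => S^-1 * `|x i| `^ r)); last first.
    move=> i _; rewrite normrZ gtr0_norm ?invr_gt0// powRM ?invr_ge0 ?(ltW N0)//.
    rewrite -powR_inv1 ?(ltW N0)// powRAC powR_inv1 ?powR_ge0//.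
    by rewrite /N -powRrM mulVf ?gt_eqF// powRr1// ltW.
  by rewrite -mulr_sumr mulVf// gt_eqF.
move=> y1.
have yi1 i : `|y i| <= 1.
  rewrite leNgt; apply/negP => yi; have : 1 < `|y i| `^ r.
    by apply: (lt_le_trans yi); rewrite le1r_powR ?(ltW yi).
  apply/negP; rewrite -leNgt; apply: le_trans y1.
  by rewrite (bigD1 i)//= lerDl sumr_ge0// => j _; exact: powR_ge0.
(* Zero vectors have no scale; [kap] is unconstrained there and the blocks leave them out. *)
have /choice[kap Hkap] i : exists k : nat, y i != 0 ->
    2 ^+ k * `|y i| <= 1 /\ 1 <= 2 ^+ k.+1 * `|y i|.
  have [yi0|yi0] := eqVneq (y i) 0; first by exists 0%N.
  have [|k Hk] := @dyadic_scale `|y i| _ (yi1 i); first by rewrite normr_gt0.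
  by exists k.
pose K := (\max_(i < n) kap i).+1.
have kapK i : (kap i < K)%N by rewrite ltnS leq_bigmax.
pose z (k : 'I_K) i := if (kap i == k) && (y i != 0) then y i else 0.
pose J (k : 'I_K) := [set i | (kap i == k) && (y i != 0)]%SET.
have -> : y = fun i => \sum_k z k i.
  apply/funext => i; rewrite (bigD1 (Ordinal (kapK i)))//= big1 ?addr0.
    by rewrite /z eqxx/=; case: eqVneq.
  by move=> k; rewrite /z -val_eqE/= eq_sym => /negPf ->.
apply: le_trans (rademacher_mean_sum _) _.
apply: le_trans (_ : \sum_(k < K) C * 2 `^ (r / s) * rho ^+ k <= _); last first.
  rewrite -mulr_sumr ler_wpM2l ?mulr_ge0 ?powR_ge0//; exact: geometric_sum_le.
apply: ler_sum => k _.
have pk : 0 < 2 ^+ k :> R by rewrite exprn_gt0.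
have pk1 : 0 < 2 ^+ k.+1 :> R by rewrite exprn_gt0.
have -> : rademacher_mean (z k) = (2 ^+ k)^-1 * rademacher_mean (fun i => 2 ^+ k *: z k i).
  by rewrite rademacher_meanZ ?(ltW pk)// mulKf// gt_eqF.
have zb : rademacher_mean (fun i => 2 ^+ k *: z k i) <= C * #|J k|%:R `^ s^-1.
  apply: HC => i.
    rewrite /z; case: ifP => [/andP[/eqP ki yi]|_]; last by rewrite scaler0 normr0.
    by rewrite normrZ gtr0_norm// -ki; exact: (Hkap i yi).1.
  by rewrite inE /z => /negPf ->; rewrite scaler0.
have cJ : #|J k|%:R <= (2 ^+ k.+1) `^ r :> R.
  rewrite -[leRHS]mulr1; apply: le_trans (_ : (2 ^+ k.+1) `^ r * \sum_(i in J k) `|y i| `^ r <= _).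
    rewrite mulr_sumr -sumr_const; apply: ler_sum => i; rewrite inE => /andP[/eqP ki yi].
    have h1 : 1 <= 2 ^+ k.+1 * `|y i| by rewrite -ki; exact: (Hkap i yi).2.
    by have := ler_powR h1 (ltW r0); rewrite powRr0 powRM ?(ltW pk1).
  rewrite ler_wpM2l ?powR_ge0//; apply: le_trans y1.
  rewrite [leRHS](bigID (mem (J k)))/= lerDl sumr_ge0// => i _; exact: powR_ge0.
have : #|J k|%:R `^ s^-1 <= (2 ^+ k.+1) `^ (r / s) :> R.
  by rewrite powRrM; apply: ge0_ler_powR; rewrite ?nnegrE ?powR_ge0 ?(ltW is0).
move=> /(ler_wpM2l C0) /(le_trans zb) h.
have ik : 0 <= (2 ^+ k)^-1 :> R by rewrite invr_ge0 ltW.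
apply: le_trans (ler_wpM2l ik h) _.
rewrite exprSr powRM ?exprn_ge0// -(powR_mulrn k (ler0n R 2)) -powRrM.
have -> : rho ^+ k = 2 `^ (k%:R * (r / s)) * (2 `^ k%:R)^-1.
  rewrite -powR_mulrn// -powRN -powRD ?(gt_eqF (ltr0n R 2)) ?implybT// -powRrM.
  by congr (_ `^ _); ring.
by rewrite le_eqVlt; apply/orP; left; apply/eqP; ring.
Qed.

End TypeFromRademacherBound.

(** * Almost orthonormal systems *)

Section Dot.
Context {R : realType} {n : nat}.
Implicit Types (u v w : 'rV[R]_n).

Definition dot u v : R := \sum_i u 0 i * v 0 i.

Lemma dotC u v : dot u v = dot v u.
Proof. by apply: eq_bigr => i _; rewrite mulrC. Qed.

Lemma dotDl u v w : dot (u + v) w = dot u w + dot v w.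
Proof. by rewrite -big_split; apply: eq_bigr => i _; rewrite mxE mulrDl. Qed.

Lemma dotZl (c : R) u w : dot (c *: u) w = c * dot u w.
Proof. by rewrite /dot mulr_sumr; apply: eq_bigr => i _; rewrite mxE mulrA. Qed.

Lemma dotDr u v w : dot w (u + v) = dot w u + dot w v.
Proof. by rewrite dotC dotDl !(dotC _ w). Qed.

Lemma dotZr (c : R) u w : dot w (c *: u) = c * dot w u.
Proof. by rewrite dotC dotZl dotC. Qed.

Lemma dot_ge0 u : 0 <= dot u u.
Proof. by apply: sumr_ge0 => i _; rewrite -expr2 sqr_ge0. Qed.

Lemma dot_suml (I : finType) (u : I -> 'rV[R]_n) w :
  dot (\sum_i u i) w = \sum_i dot (u i) w.
Proof. by rewrite /dot exchange_big/=; apply: eq_bigr => j _; rewrite summxE mulr_suml. Qed.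

Lemma dot_sumr (I : finType) (u : I -> 'rV[R]_n) w :
  dot w (\sum_i u i) = \sum_i dot w (u i).
Proof. by rewrite dotC dot_suml; apply: eq_bigr => i _; rewrite dotC. Qed.

Lemma dot_le1 u v : dot u u <= 1 -> dot v v <= 1 -> `|dot u v| <= 1.
Proof.
move=> u1 v1; rewrite ler_norml; apply/andP; split.
  have := dot_ge0 (u + v); rewrite dotDl !dotDr (dotC v u); lra.
have := dot_ge0 (u + (-1) *: v); rewrite dotDl !dotDr !dotZl !dotZr (dotC v u); lra.
Qed.

Lemma sqr_entry_le_dot u i : u 0 i ^+ 2 <= dot u u.
Proof.
rewrite /dot (bigD1 i)//= expr2 lerDl sumr_ge0// => j _.
by rewrite -expr2 sqr_ge0.
Qed.

(** For a unit vector [w] this halves the component along [w]: the squared length drops by a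
    multiple of [dot v w ^+ 2], yet the determinant stays at least 1/2. *)
Definition shrink w v : 'rV[R]_n := v - (2^-1 * dot v w) *: w.

Definition shrink_mx w : 'M[R]_n := 1%:M - 2^-1 *: (w^T *m w).

Lemma mul_shrink_mx w v : v *m shrink_mx w = shrink w v.
Proof.
rewrite /shrink_mx mulmxBr mulmx1 -scalemxAr mulmxA; congr (_ - _).
rewrite -scalerA; congr (_ *: _).
rewrite [v *m w^T]mx11_scalar mul_scalar_mx; congr (_ *: _).
by rewrite mxE; apply: eq_bigr => i _; rewrite mxE.
Qed.

Lemma dot_shrink w v : dot w w <= 1 ->
  dot (shrink w v) (shrink w v) <= dot v v - 3 / 4 * dot v w ^+ 2.
Proof.
move=> w1; rewrite /shrink -scaleNr dotDl !dotDr !dotZl !dotZr (dotC w v).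
have := sqr_ge0 (dot v w); nra.
Qed.

(** Sylvester's identity [det (1 + u w) = det (1 + w u)], read off from the two products of the same
    block matrices. *)
Lemma det_shrink_mx w : \det (shrink_mx w) = 1 - 2^-1 * dot w w.
Proof.
pose u : 'cV[R]_n := (- 2^-1) *: w^T.
have -> : shrink_mx w = 1%:M + u *m w.
  by rewrite /u -scalemxAl scaleNr.
have M1 : block_mx 1%:M w (- u) 1%:M *m block_mx 1%:M 0 u 1%:M =
    block_mx (1%:M + w *m u) w 0 1%:M.
  rewrite mulmx_block !mul1mx !mulmx1 !mulmx0 !add0r.
  by rewrite addNr.
have M2 : block_mx 1%:M 0 u 1%:M *m block_mx 1%:M w (- u) 1%:M =
    block_mx 1%:M w 0 (1%:M + u *m w).
  rewrite mulmx_block !mul1mx !mulmx1 !mul0mx !addr0.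
  by rewrite subrr [u *m w + _]addrC.
have := congr1 determinant M2; rewrite det_mulmx mulrC -det_mulmx M1.
rewrite !det_ublock !det1 mulr1 mul1r => <-.
rewrite det_mx11 !mxE eqxx /dot; congr (_ + _).
by rewrite -mulNr mulr_sumr; apply: eq_bigr => i _; rewrite !mxE; ring.
Qed.

Definition shrinks (ws : seq 'rV[R]_n) v := foldl (fun v w => shrink w v) v ws.

Lemma dot_shrinks ws v : all (fun w => dot w w <= 1) ws ->
  dot (shrinks ws v) (shrinks ws v) <= dot v v.
Proof.
elim: ws v => [|w ws IH] v //= /andP[w1 ws1].
apply: le_trans (IH _ ws1) _; apply: le_trans (dot_shrink _ w1) _.
by have := sqr_ge0 (dot v w); lra.
Qed.

(** No single shrink can lose much length, so each is applied to a vector nearly orthogonal to its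
    direction. It shifts later products by at most [eta], and these errors add up. *)
Lemma almost_orthogonal ws v (eta : R) : 0 <= eta ->
  all (fun w => dot w w <= 1) ws -> dot v v <= 1 ->
  1 - 3 / 4 * eta ^+ 2 <= dot (shrinks ws v) (shrinks ws v) ->
  forall w, w \in ws -> `|dot v w| <= eta * (size ws).+1%:R.
Proof.
move=> eta0; elim: ws v => [|w ws IH] v //= /andP[w1 ws1] v1 shv.
have d1 := dot_shrink v w1; have d2 := dot_shrinks (shrink w v) ws1.
have vw : `|dot v w| <= eta.
  rewrite -ler_sqr ?nnegrE// real_normK ?num_real//; move: shv; rewrite /shrinks/=.
  rewrite /shrinks in d2; lra.
have sv1 : dot (shrink w v) (shrink w v) <= 1.
  by have := sqr_ge0 (dot v w); lra.
move=> w'; rewrite inE => /predU1P[->|w'ws].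
  by apply: le_trans vw _; rewrite ler_peMr// ler1n.
have := IH _ ws1 sv1 shv w' w'ws.
have -> : dot v w' = dot (shrink w v) w' + 2^-1 * dot v w * dot w w'.
  by rewrite /shrink -scaleNr dotDl dotZl; ring.
have : `|dot w w'| <= 1 by apply: dot_le1 => //; exact: (allP ws1).
move=> ww' h; apply: le_trans (ler_normD _ _) _.
have : `|2^-1 * dot v w * dot w w'| <= eta.
  rewrite !normrM [`|2^-1|]ger0_norm ?invr_ge0//.
  have : `|dot v w| * `|dot w w'| <= eta * 1 by rewrite ler_pM.
  rewrite -mulrA; have := normr_ge0 (dot v w); have := normr_ge0 (dot w w'); nra.
by rewrite -(natr1 (size ws).+1) mulrDr mulr1; lra.
Qed.

End Dot.

(** * Triangular systems of vectors and functionals *)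

Section TriangularSystem.
Context {R : realType} {X : completeNormedModType R}.

Definition finitely_spanned (V : set X) := exists m (c : 'I_m -> X),
  forall x, V x -> exists a : 'I_m -> R, x = \sum_(i < m) a i *: c i.

Definition common_kernel n (f : nat -> X -> R) : set X :=
  [set x | forall i, (i < n)%N -> f i x = 0].

(** One functional lowers the dimension by at most one: a vector [v] with [f n v != 0], added to a
    family spanning the smaller kernel, spans the larger one. *)
Lemma common_kernel_infinite n (f : nat -> X -> R) : infinite_dimensional X ->
  (forall i, (i < n)%N -> scalar (f i)) -> ~ finitely_spanned (common_kernel n f).
Proof.
move=> dimX; elim: n => [_ [m [c Hc]]|n IH lf [m [c Hc]]].
  by apply: dimX; exists m, c => x; exact: Hc.
have lfn i : (i < n)%N -> scalar (f i) by move=> /ltnW; exact: lf.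
apply: (IH lfn).
have [[v [Vv fv]]|Vf] := pselect (exists v, common_kernel n f v /\ f n v != 0); last first.
  exists m, c => x Vx; apply: Hc => i; rewrite ltnS leq_eqVlt => /predU1P[->|]; last exact: Vx.
  by apply/eqP/negPn/negP => fx; apply: Vf; exists x.
exists m.+1, (fun i => if unlift ord0 i is Some j then c j else v) => x Vx.
pose t := f n x / f n v.
have fD i : (i < n.+1)%N -> f i (x + (- t) *: v) = f i x - t * f i v.
  move=> /lf li; rewrite addrC li; ring.
have [i|a xa] := Hc (x + (- t) *: v).
  rewrite ltnS leq_eqVlt => /predU1P[->|ilt]; rewrite fD//.
  - by rewrite /t divfK// subrr.
  - by rewrite Vx// Vv// mulr0 subr0.
  - exact: ltnW.
exists (fun i => if unlift ord0 i is Some j then a j else t).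
rewrite big_ord_recl unlift_none.
under eq_bigr do rewrite liftK.
by rewrite -xa scaleNr addrC subrK.
Qed.

Lemma common_kernel_unit n (f : nat -> X -> R) : infinite_dimensional X ->
  (forall i, (i < n)%N -> scalar (f i)) ->
  exists2 x, common_kernel n f x & `|x| = 1.
Proof.
move=> dimX lf; have H := common_kernel_infinite dimX lf.
have [[x [Vx x0]]|Vx] := pselect (exists x, common_kernel n f x /\ x != 0).
  exists (`|x|^-1 *: x); last by rewrite normrZ normfV normr_id mulVf// normr_eq0.
  move=> i ilt; have := lf i ilt (`|x|^-1) x 0.
  by rewrite !addr0 (Vx i ilt) (scalar0 (lf i ilt)) mulr0 addr0.
exfalso; apply: H; exists 0%N, (fun=> 0) => x Hx; exists (fun=> 0).
rewrite big_ord0; apply/eqP/negPn/negP => x0; apply: Vx; by exists x.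
Qed.

(** Each new vector is a unit vector in the common kernel of the earlier functionals, and the new
    functional norms it. *)
Lemma triangular_system n : infinite_dimensional X ->
  exists (b : nat -> X) (f : nat -> X -> R), forall j, (j < n)%N ->
    [/\ contractive_functional (f j), `|b j| = 1, f j (b j) = 1 &
      forall i, (i < j)%N -> f i (b j) = 0].
Proof.
move=> dimX; elim: n => [|n [b [f bf]]]; first by exists (fun=> 0), (fun=> fun=> 0).
have [|x Vx x1] := @common_kernel_unit n f dimX.
  by move=> i /bf[[]].
have [g cg gx] := norming_functional x.
exists (fun i => if i == n then x else b i), (fun i => if i == n then g else f i) => j.
rewrite ltnS leq_eqVlt => /predU1P[->|jn].
  rewrite eqxx; split=> //; first by rewrite gx.
  by move=> i ilt; rewrite (ltn_eqF ilt); exact: Vx.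
rewrite (ltn_eqF jn); have [cj bj fj fi] := bf j jn; split=> // i ij.
by rewrite (ltn_eqF (ltn_trans ij jn)); exact: fi.
Qed.

End TriangularSystem.

(** * Determinant maximisation after Dvoretzky and Rogers *)

Section DvoretzkyRogers.
Context {R : realType} {X : completeNormedModType R}.
Hypothesis dimX : infinite_dimensional X.

Definition euclidean_contraction n (T : X -> 'rV[R]_n) :=
  linear T /\ forall x, dot (T x) (T x) <= `|x| ^+ 2.

Definition coord_mx n (b : 'I_n -> X) (T : X -> 'rV[R]_n) : 'M[R]_n :=
  \matrix_(j, i) T (b j) 0 i.

Lemma coord_mx_mul n (b : 'I_n -> X) (T : X -> 'rV[R]_n) (M : 'M[R]_n) :
  coord_mx b (fun x => T x *m M) = coord_mx b T *m M.
Proof.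
apply/matrixP => j i; rewrite !mxE; apply: eq_bigr => l _; by rewrite !mxE.
Qed.

(** A crude bound from the Leibniz formula; it only has to make the supremum of determinants
    finite. *)
Lemma det_coord_mx_le n (b : 'I_n -> X) (T : X -> 'rV[R]_n) :
  (forall i, `|b i| <= 1) -> euclidean_contraction T ->
  `|\det (coord_mx b T)| <= (n`!)%:R.
Proof.
move=> b1 [_ cT]; rewrite /determinant; apply: le_trans (ler_norm_sum _ _ _) _.
rewrite -[leRHS](_ : \sum_(s : 'S_n) 1 = _); last by rewrite sumr_const card_Sn.
apply: ler_sum => s _; rewrite normrM normrX normrN1 expr1n mul1r normr_prod.
apply: prodr_ile1 => i _; rewrite normr_ge0 /= !mxE.
rewrite -(ler_pXn2r (isT : 0 < 2)%N) ?nnegrE// expr1n real_normK ?num_real//.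
apply: le_trans (sqr_entry_le_dot _ _) _; apply: le_trans (cT _) _.
by rewrite expr_le1.
Qed.

(** The functionals of a triangular system, divided by the dimension to make the map a contraction,
    yield a triangular matrix with nonzero diagonal. *)
Lemma det_coord_mx_neq0 n : exists (b : 'I_n -> X) (T : X -> 'rV[R]_n),
  [/\ forall i, `|b i| <= 1, euclidean_contraction T & \det (coord_mx b T) != 0].
Proof.
have [b [f bf]] := triangular_system n dimX.
case: n bf => [|n] bf.
  exists (fun=> 0), (fun=> 0); split.
  - by case.
  - by split=> [a u v|x]; rewrite ?scaler0 ?addr0// /dot big_ord0 sqr_ge0.
  - by rewrite det_mx00 oner_eq0.
pose T x : 'rV[R]_n.+1 := \row_i (n.+1%:R^-1 * f i x).
exists (fun i => b i), T; split.
- by move=> i; have [_ -> _ _] := bf i (ltn_ord i).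
- split=> [a u v|x].
    apply/rowP => i; rewrite !mxE; have [[lf _] _ _ _] := bf i (ltn_ord i).
    by rewrite lf; ring.
  have n1 : 1 <= n.+1%:R :> R by rewrite ler1n.
  apply: le_trans (_ : \sum_(i < n.+1) n.+1%:R^-1 * `|x| ^+ 2 <= _); last first.
    by rewrite sumr_const card_ord -[_ *+ _]mulr_natl mulVKf// pnatr_eq0.
  apply: ler_sum => i _; rewrite !mxE.
  have [[_ cf] _ _ _] := bf i (ltn_ord i).
  have : f i x ^+ 2 <= `|x| ^+ 2.
    by rewrite -[leLHS]real_normK ?num_real// lerXn2r ?nnegrE.
  have : 0 < n.+1%:R^-1 :> R by rewrite invr_gt0.
  have : n.+1%:R^-1 <= 1 :> R by rewrite invf_le1.
  set c := _^-1; move=> c1 c0 fx.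
  have := sqr_ge0 (f i x); have := ler_wpM2l (ltW c0) fx.
  nra.
- rewrite -det_tr det_trig; last first.
    apply/is_trig_mxP => i j ij; rewrite !mxE.
    by have [_ _ _ ->] := bf j (ltn_ord j); rewrite ?mulr0.
  rewrite prodf_seq_neq0; apply/allP => i _; rewrite !mxE.
  by have [_ _ -> _] := bf i (ltn_ord i); rewrite mulr1 invr_eq0 pnatr_eq0.
Qed.

(** A map beyond half of the supremum always exists, which replaces a compactness argument for a
    maximiser. *)
Lemma almost_maximal_contraction n : exists (b : 'I_n -> X) (T : X -> 'rV[R]_n) (D : R),
  [/\ euclidean_contraction T, 0 < D, D < 2 * `|\det (coord_mx b T)| &
    forall T', euclidean_contraction T' -> `|\det (coord_mx b T')| <= D].
Proof.
have [b [T0 [b1 cT0 d0]]] := det_coord_mx_neq0 n.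
pose E := [set `|\det (coord_mx b T)| | T in @euclidean_contraction n].
have hsE : has_sup E.
  split; first by exists `|\det (coord_mx b T0)|, T0.
  by exists (n`!)%:R => _ [T cT <-]; exact: det_coord_mx_le.
have ubE T : euclidean_contraction T -> `|\det (coord_mx b T)| <= sup E.
  by move=> cT; apply: ub_le_sup; [case: hsE | exists T].
have E0 : 0 < sup E by apply: lt_le_trans (ubE _ cT0); rewrite normr_gt0.
have [|_ [T cT <-] TE] := @sup_adherent R E (sup E / 2) _ hsE.
  by rewrite divr_gt0.
by exists b, T, (sup E); split=> //; lra.
Qed.

Lemma expn_unbounded (a C : R) : 1 < a -> exists n, C <= a ^+ n.
Proof.
move=> a1; have a0 : 0 < a - 1 by lra.
have bern n : 1 + n%:R * (a - 1) <= a ^+ n.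
  elim: n => [|n IH]; first by rewrite mul0r addr0.
  rewrite exprS -natr1.
  have : 0 <= n%:R * (a - 1) ^+ 2 by rewrite mulr_ge0 ?sqr_ge0.
  nra.
have := archi_boundP (normr_ge0 (C / (a - 1))).
set n := Num.Def.archi_bound _ => nC; exists n; apply: le_trans (bern n).
have : C / (a - 1) < n%:R by apply: le_lt_trans (ler_norm _) nC.
by rewrite ltr_pdivrMr//; lra.
Qed.

(* If [T] almost maximises the determinant, then shrinking [T] in the directions
   already chosen and dilating it slightly elsewhere violates [|T x| <= `|x|];
   a vector witnessing this is almost orthogonal to the chosen ones. *)
Lemma almost_orthonormal k (eta : R) : 0 < eta -> eta <= 1 ->
  exists n (T : X -> 'rV[R]_n) (us : seq X),
  [/\ euclidean_contraction T, size us = k,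
    {in us, forall u, `|u| <= 1 /\ 1 - 3 / 4 * eta ^+ 2 <= dot (T u) (T u)} &
    pairwise (fun u v => `|dot (T u) (T v)| <= eta * k%:R) us].
Proof.
move=> e0 e1; pose delta := 3 / 4 * eta ^+ 2.
have d0 : 0 < delta by rewrite mulr_gt0// exprn_gt0.
have d1 : delta < 1 by rewrite /delta; nra.
pose a := 1 + delta / 2; have a1 : 1 < a by rewrite /a; lra.
have a0 : 0 < a by lra.
have ad : (1 - delta) * a ^+ 2 <= 1.
  by rewrite /a; have := exprn_ge0 3 (ltW d0); nra.
(* Dilation by [a] multiplies the determinant by [a ^+ n]. This outweighs the factor [2^-1 ^+ j]
   lost to [j < k] shrinks and leaves a factor of at least 2. *)
have [n na] := expn_unbounded (2 ^+ k.+1) a1.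
have [b [T [D [cT D0 DT Dmax]]]] := almost_maximal_contraction n.
exists n, T.
suff : forall j, (j <= k)%N -> exists us : seq X, [/\ size us = j,
    {in us, forall u, `|u| <= 1 /\ 1 - delta <= dot (T u) (T u)} &
    pairwise (fun u v => `|dot (T u) (T v)| <= eta * k%:R) us].
  by move=> /(_ k (leqnn k))[us [sus us1 pus]]; exists us.
elim=> [_|j IH jk]; first by exists [::].
have [us [sus us1 pus]] := IH (ltnW jk).
pose ws := map T us.
have ws1 : all (fun w => dot w w <= 1) ws.
  apply/allP => _ /mapP[u uus ->]; apply: le_trans (cT.2 u) _.
  by rewrite expr_le1// (us1 u uus).1.
pose M := a *: foldr (fun w M => shrink_mx w *m M) 1%:M ws.
have TM x : T x *m M = a *: shrinks ws (T x).
  rewrite /M -scalemxAr; congr (_ *: _); rewrite /shrinks.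
  elim: ws (T x) {ws1 M} => [|w ws IHw] v /=; first by rewrite mulmx1.
  by rewrite mulmxA mul_shrink_mx IHw.
have detM : 2 <= \det M.
  rewrite /M detZ.
  have : 2^-1 ^+ j <= \det (foldr (fun w M => shrink_mx w *m M) 1%:M ws).
    have <- : size ws = j by rewrite size_map.
    elim: ws ws1 {M TM} => [_|w ws IHw /= /andP[w1 /IHw h]]; first by rewrite det1.
    rewrite det_mulmx exprS ler_pM ?exprn_ge0 ?invr_ge0// det_shrink_mx; lra.
  move=> h; apply: le_trans (_ : 2 ^+ k.+1 * 2^-1 ^+ j <= _); last first.
    by rewrite ler_pM ?exprn_ge0 ?invr_ge0.
  rewrite exprVn ler_pdivlMr ?exprn_gt0// -exprS ler_weXn2l ?ler1n//.
  by rewrite ltnS ltnW.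
(* Otherwise [T] followed by [M] would be a contraction whose determinant is at least twice that of
   [T] in absolute value, hence above [D]. *)
have [x xM] : exists x, `|x| ^+ 2 < dot (T x *m M) (T x *m M).
  apply: contrapT => /forallNP H.
  have cTM : euclidean_contraction (fun x => T x *m M).
    split=> [c u v|x]; last by rewrite leNgt; apply/negP; exact: H.
    by rewrite cT.1 mulmxDl scalemxAl.
  have := Dmax _ cTM; rewrite coord_mx_mul det_mulmx normrM.
  have : 2 <= `|\det M| by apply: le_trans (ler_norm _).
  have := normr_ge0 (\det (coord_mx b T)); nra.
have T0 : T 0 = 0.
  by have := cT.1 (-1) 0 0; rewrite scaler0 addr0 scaleN1r addNr.
have x0 : x != 0.
  apply/eqP => x0; move: xM; rewrite x0 T0 mul0mx normr0 expr0n/=.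
  by rewrite /dot big1 ?ltxx// => i _; rewrite mxE mul0r.
have nx0 : 0 < `|x| by rewrite normr_gt0.
pose u := `|x|^-1 *: x.
have u1 : `|u| = 1 by rewrite normrZ normfV normr_id mulVf// gt_eqF.
have Tu : T u = `|x|^-1 *: T x by have := cT.1 (`|x|^-1) x 0; rewrite T0 !addr0.
have uM : 1 <= a ^+ 2 * dot (shrinks ws (T u)) (shrinks ws (T u)).
  have : 1 <= dot (T u *m M) (T u *m M).
    rewrite Tu -scalemxAl dotZl dotZr mulrA -expr2 exprVn.
    by rewrite ler_pdivlMl ?exprn_gt0// mulr1 ltW.
  by rewrite TM dotZl dotZr mulrA -expr2.
have Tu1 : dot (T u) (T u) <= 1 by apply: le_trans (cT.2 u) _; rewrite u1 expr1n.
have shu : 1 - delta <= dot (shrinks ws (T u)) (shrinks ws (T u)).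
  have a20 : 0 < a ^+ 2 by rewrite exprn_gt0.
  by rewrite -(ler_pM2l a20); lra.
exists (u :: us); split.
- by rewrite /= sus.
- move=> v; rewrite inE => /predU1P[->|]; last exact: us1.
  by rewrite u1; split=> //; apply: le_trans shu _; exact: dot_shrinks.
- rewrite /= pus andbT; apply/allP => v vus.
  apply: le_trans (almost_orthogonal (ltW e0) ws1 Tu1 shu (map_f T vus)) _.
  by rewrite ler_pM2l// size_map sus ler_nat.
Qed.

Lemma sqr_sum_le k (a : 'I_k -> R) :
  (\sum_i `|a i|) ^+ 2 <= k%:R * \sum_i a i ^+ 2.
Proof.
case: k a => [|k] a; first by rewrite !big_ord0 mulr0 expr0n.
set S := \sum_i `|a i|; set Q := \sum_i a i ^+ 2; set m : R := k.+1%:R.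
have m0 : 0 < m by rewrite ltr0n.
have : 0 <= \sum_i (m * `|a i| - S) ^+ 2 by apply: sumr_ge0 => i _; exact: sqr_ge0.
rewrite (_ : \sum_i _ = m * (m * Q - S ^+ 2)); first by rewrite pmulr_rge0// subr_ge0.
rewrite (eq_bigr (fun i => m ^+ 2 * a i ^+ 2 - 2 * m * S * `|a i| + S ^+ 2)).
  rewrite big_split sumrB -!mulr_sumr sumr_const card_ord -[S *+ _]mulr_natl -/m -/S -/Q /=.
  by ring.
by move=> i _; rewrite -[a i ^+ 2]real_normK ?num_real//; ring.
Qed.

(** Let [S] be the l1 norm of [a]. Near-orthonormality bounds the squared norm of the combination
    below by [sum a_i^2 - eta k S^2], and Cauchy-Schwarz gives [sum a_i^2 >= S^2 / k]. The choice
    [eta k = 1 / k - eps^2] leaves [eps^2 S^2]. *)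
Lemma lower_l1_two k (eps : R) : 0 < eps -> eps ^+ 2 * k%:R < 1 -> (0 < k)%N ->
  exists2 x : 'I_k -> X, forall i, `|x i| <= 1 & lower_l1 eps x.
Proof.
move=> e0 ek k0; have k0' : 0 < k%:R :> R by rewrite ltr0n.
have k1 : 1 <= k%:R :> R by rewrite ler1n.
pose eta := (k%:R^-1 - eps ^+ 2) / k%:R.
have ik1 : k%:R^-1 <= 1 :> R by rewrite invf_le1.
have rho0 : 0 < k%:R^-1 - eps ^+ 2 by rewrite subr_gt0 -[ltRHS]mul1r ltr_pdivlMr.
have etak : eta * k%:R = k%:R^-1 - eps ^+ 2 by rewrite divfK// gt_eqF.
have eta0 : 0 < eta by rewrite divr_gt0.
have eta1 : eta <= 1.
  by rewrite ler_pdivrMr//; have := exprn_gt0 2 e0; lra.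
have [n [T [us [cT sus us1 /(pairwiseP 0) pus]]]] := almost_orthonormal k eta0 eta1.
pose x (i : 'I_k) := us`_i.
have xus i : x i \in us by rewrite mem_nth// sus.
exists x => [i|a]; first exact: (us1 _ (xus i)).1.
have T0 : T 0 = 0.
  by have := cT.1 (-1) 0 0; rewrite scaler0 addr0 scaleN1r addNr.
have TS : T (\sum_i a i *: x i) = \sum_i a i *: T (x i).
  by elim/big_rec2: _ => // i u v _ <-; exact: cT.1.
rewrite -ler_sqr ?nnegrE//; last by rewrite mulr_ge0 ?(ltW e0)// sumr_ge0.
apply: le_trans (cT.2 _); rewrite TS dot_suml.
under [leRHS]eq_bigr do rewrite dotZl dot_sumr mulr_sumr.
apply: le_trans (_ : \sum_i (a i ^+ 2 - \sum_j eta * k%:R * `|a i| * `|a j|) <= _); last first.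
  apply: ler_sum => i _; rewrite (bigD1 i)//= [leRHS](bigD1 i)//= opprD addrA.
  apply: lerD.
    have [_ h] := us1 _ (xus i); rewrite dotZr -mulrA -expr2 real_normK ?num_real// mulrA -expr2.
    have : 3 / 4 * eta ^+ 2 <= eta * k%:R by nra.
    by have := sqr_ge0 (a i); nra.
  rewrite -sumrN; apply: ler_sum => j ji.
  have dij : `|dot (T (x i)) (T (x j))| <= eta * k%:R.
    have [ij|ij|ij] := ltngtP i j.
    - by apply: pus; rewrite ?inE ?sus.
    - by rewrite dotC; apply: pus; rewrite ?inE ?sus.
    - by move: ji; rewrite (ord_inj ij) eqxx.
  rewrite dotZr lerNl; apply: le_trans (ler_norm _) _; rewrite normrN !normrM.
  rewrite mulrA mulrC [leRHS]mulrC mulrA [leRHS]mulrA.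
  have := ler_wpM2l (mulr_ge0 (normr_ge0 (a j)) (normr_ge0 (a i))) dij; lra.
rewrite sumrB; under [X in _ - X]eq_bigr do rewrite -mulr_sumr.
rewrite -mulr_suml -mulr_sumr etak.
have := sqr_sum_le a; set S := \sum_i `|a i|; set Q := \sum_i a i ^+ 2.
rewrite mulrC -ler_pdivrMr// => h; rewrite exprMn; lra.
Qed.

End DvoretzkyRogers.

(** * Lower bound *)

Section MaximalL1.
Context {R : realType} {X : completeNormedModType R}.
Hypothesis dimX : infinite_dimensional X.

Lemma lower_l1_le (eps eps' : R) (I : finType) (x : I -> X) : eps <= eps' ->
  lower_l1 eps' x -> lower_l1 eps x.
Proof. by move=> ee lx a; apply: le_trans (lx a); rewrite ler_wpM2r// sumr_ge0. Qed.

(** With [q = 1 / theta], absence of such systems gives l1 decay of order [q]. If [1 - theta] were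
    below [1 / p-star], an exponent [1 / s] halfway between them would give a type larger than
    [p-star]. *)
Lemma inv_type_sup_le_of_small N (eps theta : R) : (1 < N)%N -> 0 < theta ->
  theta <= 2^-1 -> eps <= N%:R `^ (- theta) ->
  (forall x : 'I_N -> X, (forall i, `|x i| <= 1) -> ~ lower_l1 eps x) ->
  (type_sup X)^-1 <= 1 - theta.
Proof.
move=> N1 th0 th2 epsN Nsmall; rewrite leNgt; apply/negP.
set ps := type_sup X => thps.
have [x0 x00] := infinite_dimensional_neq0 dimX.
have ps1 : 1 <= ps := type_sup_ge1 x00.
have N0 : 0 < N%:R :> R by rewrite ltr0n ltnW.
have q2 : 2 <= theta^-1 by rewrite -[2]invrK lef_pV2// posrE ?invr_gt0.
have Aq : l1_decay (X := X) N%:R theta^-1.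
  apply: (@l1_decay_of_small _ _ N (N%:R `^ (- theta))) => //.
  - exact: powR_gt0.
  - by rewrite -powRrM mulNr mulfV ?gt_eqF// powR_inv1// ltW.
  - by rewrite invr_ge0 ltW.
  - by move=> x x1 /(lower_l1_le epsN); exact: Nsmall.
pose s := ((1 - theta + ps^-1) / 2)^-1.
have is0 : 0 < (1 - theta + ps^-1) / 2.
  have : 0 < ps^-1 by rewrite invr_gt0; lra.
  lra.
have pss : ps < s.
  rewrite /s -[ps]invrK ltf_pV2 ?posrE ?invr_gt0//; lra.
have [||C C0 HC] := @set_rademacher_bound_of_decay _ _ _ _ s _ q2 Aq.
- by rewrite ler1n ltnW.
- by rewrite /s !invrK; lra.
have : has_type X ((ps + s) / 2) by apply: has_type_of_set_bound C0 HC _ _; lra.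
by move=> /(has_type_le_sup x00); rewrite -/ps; lra.
Qed.

Lemma l1_system N (eps : R) : (0 < N)%N -> 0 < eps ->
  eps * N%:R `^ (1 - (type_sup X)^-1) < 1 ->
  exists2 x : 'I_N -> X, forall i, `|x i| <= 1 & lower_l1 eps x.
Proof.
move=> N0 e0 epsN; have [x0 x00] := infinite_dimensional_neq0 dimX.
set ps := type_sup X in epsN.
have ps1 : 1 <= ps := type_sup_ge1 x00.
have ps2 : ps <= 2 := type_sup_le2 x00.
have ps0 : 0 < ps by lra.
have N0' : 0 < N%:R :> R by rewrite ltr0n.
have [N1|N1] := leqP N 1.
  have {N1}NE : N = 1%N by apply/eqP; rewrite eqn_leq N1.
  move: epsN; rewrite {}NE powR1 mulr1 => e1.
  exists (fun=> `|x0|^-1 *: x0) => [_|a].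
    by rewrite normrZ normfV normr_id mulVf// normr_eq0.
  rewrite !big_ord1 !normrZ normfV normr_id mulVf ?normr_eq0// mulr1.
  by rewrite ler_piMl// ltW.
have [ps2'|ps2'] := leP 2 ps.
  apply: lower_l1_two => //; move: epsN; rewrite (_ : 1 - ps^-1 = 2^-1); last first.
    have -> : ps = 2 by lra.
    by lra.
  move=> h; have : (eps * N%:R `^ 2^-1) ^+ 2 < 1 by rewrite expr_lt1// mulr_ge0 ?powR_ge0 ?(ltW e0).
  by rewrite exprMn -(powR_mulrn 2 (powR_ge0 N%:R 2^-1)) -powRrM mulVf// powRr1// ltW.
apply: contrapT => Nsmall.
have Nsmall' (x : 'I_N -> X) : (forall i, `|x i| <= 1) -> ~ lower_l1 eps x.
  by move=> x1 lx; apply: Nsmall; exists x.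
have lnN : 0 < ln N%:R :> R by rewrite ln_gt0// ltr1n.
pose theta0 := 1 - ps^-1; pose theta1 := - ln eps / ln N%:R.
have ips : ps^-1 <= 1 by rewrite invf_le1.
have ips2 : 2^-1 < ps^-1 by rewrite ltf_pV2 ?posrE.
have th01 : theta0 < theta1.
  rewrite /theta1 ltr_pdivlMr// -subr_gt0 -opprD oppr_gt0 -ln_powR.
  rewrite -lnM ?posrE ?powR_gt0// ln_lt0// epsN andbT.
  by rewrite mulr_gt0 ?powR_gt0.
have epsE : eps = N%:R `^ (- theta1).
  rewrite /powR gt_eqF// (_ : - theta1 * _ = ln eps) ?lnK//.
  by rewrite /theta1; field; rewrite gt_eqF.
(* Here [eps] is [N ^ (- theta1)]. The minimum with 1/2 secures [1 / theta >= 2], and [p-star < 2]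
   leaves room between it and [theta0]. *)
pose theta := (theta0 + Num.min theta1 2^-1) / 2.
have th_lt : theta0 < Num.min theta1 2^-1 by rewrite lt_min th01 /theta0; lra.
have mle1 : Num.min theta1 2^-1 <= theta1 by rewrite ge_min lexx.
have mle2 : Num.min theta1 2^-1 <= 2^-1 :> R by rewrite ge_min lexx orbT.
have th0 : 0 <= theta0 by rewrite /theta0; lra.
have : ps^-1 <= 1 - theta.
  apply: (@inv_type_sup_le_of_small N eps theta) => //.
  - by rewrite /theta; lra.
  - by rewrite /theta; lra.
  - by rewrite epsE ler_powR ?ler1n// lerN2 /theta; lra.
by move: th_lt; rewrite /theta /theta0; lra.
Qed.

End MaximalL1.

(** The largest natural number strictly below [y]. Strictness is what [l1_system] requires, and it
    accounts for the [- 1] in the lower bound. *)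
Lemma nat_below {R : realType} (y : R) : 1 < y ->
  exists2 N : nat, (0 < N)%N & N%:R < y <= N%:R + 1.
Proof.
move=> y1; have /andP[My yM] := @truncn_itv R y (le_trans ler01 (ltW y1)).
set M := Num.truncn y in My yM; have [ly|ly|My'] := ltgtP M%:R y.
- exists M; last by rewrite ly natr1 ltW.
  by rewrite truncn_gt0 ltW.
- by move: My; rewrite leNgt ly.
- have M1 : (1 < M)%N by rewrite -(ltr_nat R) My'.
  have -> : y = M.-1%:R + 1 by rewrite natr1 prednK// ltnW.
  by exists M.-1; [rewrite -ltnS prednK// ltnW | rewrite ltrDl ltr01 lexx].
Qed.

Theorem theorem3p4 (R : realType) (X : completeNormedModType R)
    (dimX : infinite_dimensional X) :
  ((forall eps : R, 0 < eps ->
      VC eps (dual_unit_ball X) (unit_ball X) \is a fin_num)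
   <-> nontrivial_type X)
  /\
  (forall p : R, 1 < p -> has_type X p -> forall eps : R, 0 < eps ->
     ((((1 / eps) `^ (type_sup X / (type_sup X - 1)) - 1)%:E
        <= VC eps (dual_unit_ball X) (unit_ball X))%E
      /\
      (VC eps (dual_unit_ball X) (unit_ball X)
        <= ((type_constant X p / eps) `^ (p / (p - 1)) + 1)%:E)%E)).
Proof.
have [x0 x00] := infinite_dimensional_neq0 dimX.
have upper p eps : 1 < p -> has_type X p -> 0 < eps ->
    (VC eps (dual_unit_ball X) (unit_ball X)
        <= ((type_constant X p / eps) `^ (p / (p - 1)) + 1)%:E)%E.
  move=> p1 tp e0; have HT := type_constantP x00 tp.
  apply: VC_le => n x x1 lx; apply: le_trans (_ : (type_constant X p / eps) `^ (p / (p - 1)) <= _).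
    exact: lower_l1_card_le (type_bound_ge0 x00 HT) e0 HT x1 lx.
  by rewrite lerDl.
split.
  split=> [finVC|ps1 eps e0].
    rewrite /nontrivial_type ltNge; apply/negP => ps1.
    have ps : type_sup X = 1.
      by apply/eqP; rewrite eq_le ps1 (type_sup_ge1 x00).
    (* If [p-star = 1], the exponent [1 - 1 / p-star] vanishes, so [eps = 1/2] admits systems of
       every size. *)
    have VCN N : (0 < N)%N -> (N%:R%:E <= VC 2^-1 (dual_unit_ball X) (unit_ball X))%E.
      move=> N0; have [||x x1 lx] := @l1_system R X dimX N 2^-1 N0.
      - by rewrite invr_gt0.
      - by rewrite ps invr1 subrr powRr0 mulr1 invf_lt1// ltr1n.
      - by apply: VC_ge lx; rewrite ?invr_gt0.
    have /fineK VCE := finVC 2^-1 (ltac:(by rewrite invr_gt0)).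
    have := archi_boundP (normr_ge0 (fine (VC 2^-1 (dual_unit_ball X) (unit_ball X)))).
    set N := Num.Def.archi_bound _ => VN.
    have := VCN N.+1 isT; rewrite -VCE lee_fin; apply/negP; rewrite -ltNge.
    apply: le_lt_trans (ler_norm _) _; apply: lt_trans VN _.
    by rewrite ltr_nat.
  have [p p1 tp] := lt_type_sup x00 ps1.
  rewrite ge0_fin_numE; last exact: VC_ge0.
  exact: le_lt_trans (upper p eps p1 tp e0) (ltry _).
move=> p p1 tp eps e0; split; last exact: upper.
have ps1 : 1 < type_sup X := lt_le_trans p1 (has_type_le_sup x00 tp).
set ps := type_sup X in ps1 *; set y := (1 / eps) `^ _.
(* For [y <= 1] the claimed lower bound is nonpositive. *)
have [y1|y1] := leP y 1.
  by apply: le_trans (@VC_ge0 R X eps e0); rewrite lee_fin; lra.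
have [N N0 /andP[Ny yN]] := nat_below y1.
have ps0 : 0 < ps by lra.
have ips : 0 < 1 - ps^-1 by rewrite subr_gt0 invf_lt1.
have ypow : y `^ (1 - ps^-1) = 1 / eps.
  rewrite /y -powRrM (_ : ps / (ps - 1) * (1 - ps^-1) = 1) ?powRr1//.
    by rewrite divr_ge0// ltW.
  by field; rewrite !gt_eqF// subr_gt0.
have [|x x1 lx] := @l1_system R X dimX N eps N0 e0.
  by rewrite -/ps mulrC -ltr_pdivlMr// -ypow gt0_ltr_powR// nnegrE ?powR_ge0.
by apply: le_trans (VC_ge e0 x1 lx); rewrite lee_fin; lra.
Qed.
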